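(* Consider the inductive construction process which starts with the edge $I$ and in each step constructs from every polytope $\mathcal{P}$ obtained in the previous step the two new polytopes $\mathcal{P} \times I$ and $\mathcal{P} * pt$. Attach to each polytope $\mathcal{P}$ of this process a triple consisting of $A(\mathcal{P})$ (a group, or the symbol $null$), an integer $k(\mathcal{P})$, and $prod(\mathcal{P}) \in \{cartesian, join\}$, as follows, where $null \times A = A$ for every $A$. Initial data: $A(I)=null$, $k(I)=1$, $prod(I)=cartesian$; and $A(I*pt)=null$, $k(I*pt)=3$, $prod(I*pt)=join$. For all remaining polytopes, inductively: (i) If $prod(\mathcal{P})=cartesian$, then $A(\mathcal{P}\times I)=A(\mathcal{P})$, $k(\mathcal{P}\times I)=k(\mathcal{P})+1$, $prod(\mathcal{P}\times I)=cartesian$. (ii) If $prod(\mathcal{P})=join$, then $A(\mathcal{P}\times I)=A(\mathcal{P})\times Sym(k(\mathcal{P}))$, $k(\mathcal{P}\times I)=1$, $prod(\mathcal{P}\times I)=cartesian$. (iii) If $prod(\mathcal{P})=cartesian$, then $A(\mathcal{P}*pt)=A(\mathcal{P})\times\left((\mathbb{Z}/2\mathbb{Z})^{k(\mathcal{P})}\rtimes Sym(k(\mathcal{P}))\right)$, $k(\mathcal{P}*pt)=1$, $prod(\mathcal{P}*pt)=join$. (iv) If $prod(\mathcal{P})=join$, then $A(\mathcal{P}*pt)=A(\mathcal{P})$, $k(\mathcal{P}*pt)=k(\mathcal{P})+1$, $prod(\mathcal{P}*pt)=join$. Then for every polytope $\mathcal{P}$ of the process: if $prod(\mathcal{P})=cartesian$,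 then $$Aut(\mathcal{P})\cong A(\mathcal{P})\times\left((\mathbb{Z}/2\mathbb{Z})^{k(\mathcal{P})}\rtimes Sym(k(\mathcal{P}))\right),$$ and if $prod(\mathcal{P})=join$, then $$Aut(\mathcal{P})\cong A(\mathcal{P})\times Sym(k(\mathcal{P})).$$
   Context: An abstract polytope $\mathcal{P}$ of rank $n$ ($n\ge -1$) is a partially ordered set such that: (i) it has a minimal element $0_{\mathcal{P}}$ and a maximal element $1_{\mathcal{P}}$; (ii) every maximal totally ordered subset contains exactly $n+2$ elements including $0_{\mathcal{P}}$ and $1_{\mathcal{P}}$; this gives a rank function $rank_{\mathcal{P}}\colon \mathcal{P}\to\{-1,0,\dots,n\}$ with $rank(0_{\mathcal{P}})=-1$ and $rank(1_{\mathcal{P}})=n$; (iii) every section $G/F=\{H\mid F\le H\le G\}$, for $F\le G$ in $\mathcal{P}$ (including $\mathcal{P}=1_{\mathcal{P}}/0_{\mathcal{P}}$), is connected, meaning that either $rank(G)-rank(F)\le 2$, or any two elements $F',G'\in G/F$ different from $F$ and $G$ are joined by a sequence $F'=H^0,H^1,\dots,H^k=G'$ of elements of $G/F$ different from $F$ and $G$ with $H^i$ and $H^{i+1}$ comparable for all $i$; (iv) (diamond condition) for $F\le G$ with $rank(G)-rank(F)=2$ there are exactly two elements $H$ with $F<H<G$. Polytopes are considered up to order isomorphism. An automorphism is a bijection of the polytope to itself preserving the order in both directions; $Aut(\mathcal{P})$ is the group of automorphisms. The polytopes $pt$ of rank $0$ and $I$ (the edge) of rank $1$ are unique up to isomorphism.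 For abstract polytopes $\mathcal{P},\mathcal{Q}$, the join is $\mathcal{P}*\mathcal{Q}=\{(F,G)\mid F\in\mathcal{P},G\in\mathcal{Q}\}$ and the Cartesian product is $\mathcal{P}\times\mathcal{Q}=\{(F,G)\mid F\in\mathcal{P},G\in\mathcal{Q},\ rank_{\mathcal{P}}(F),rank_{\mathcal{Q}}(G)\ge 0\}\cup\{(0_{\mathcal{P}},0_{\mathcal{Q}})\}$, both ordered by $(F,G)\le(F',G')$ iff $F\le F'$ and $G\le G'$. Both are again abstract polytopes. The polytopes of the process are given by their construction sequences (finite sequences of operations $\times I$ and $*pt$ applied successively to $I$), and the attached data are defined by recursion along the construction sequence. The symbol $null$ plays the role of the trivial group in direct products. $Sym(k)$ is the symmetric group on $k$ letters, and in $(\mathbb{Z}/2\mathbb{Z})^k\rtimes Sym(k)$ the group $Sym(k)$ acts by permuting the coordinates. *)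

(* Defs.v *)
Set Warnings "-notation-overridden,-ambiguous-paths,-redundant-canonical-projection,-projection-no-head-constant".
From HB Require Import structures.
From mathcomp Require Import all_boot all_order all_fingroup all_algebra.
From mathcomp Require Import zify.

Set Implicit Arguments.
Unset Strict Implicit.
Unset Printing Implicit Defensive.

Import Order.TTheory GRing.Theory Num.Theory.

Local Open Scope order_scope.

Section AbstractPolytope.
Context {d : Order.disp_t} {T : finTBPOrderType d}.
Implicit Types (x y z F G H : T) (C D E : {set T}).

Definition chain C : bool := [forall x in C, forall y in C, x >=< y].

Definition chainle F C : bool := chain C && [forall x in C, x <= F].

(* In a polytope all maximal chains of the section F / 0 have the same number
   of elements, which is rank F + 2. *)
Definition rank F : int := ((\max_(C : {set T} | chainle F C) #|C|)%N%:Z - 2)%R.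

(* The section G / F without F and G. *)
Definition proper_section F G : {set T} := [set H | F < H < G].

Definition section_rel F G : rel T :=
  [rel x y | [&& x \in proper_section F G, y \in proper_section F G & x >=< y]].

(* The existence of 0 and 1 is part of the structure finTBPOrderType, as
   \bot and \top. *)
Record is_polytope (n : int) : Prop := IsPolytope {
  _ : (-1 <= n)%R;
  _ : forall C, maxset chain C -> (#|C|%:Z = n + 2)%R;
  _ : forall F G, F <= G ->
        (rank G - rank F <= 2)%R \/
        {in proper_section F G &, forall F' G', connect (section_rel F G) F' G'};
  _ : forall F G, F <= G -> (rank G - rank F = 2)%R ->
        #|proper_section F G| = 2
}.

(* The rank can be computed, up to a shift by one, as any nat-valued function
   increasing by one along covering relations. *)
Definition is_grading (r : T -> nat) : Prop :=
  r \bot = 0 /\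
  forall x y, x < y -> proper_section x y = set0 -> r y = (r x).+1.

Lemma chainP C : reflect {in C &, forall x y, x >=< y} (chain C).
Proof.
apply: (iffP forall_inP) => [h x y xC yC|h x xC].
  exact: (forall_inP (h x xC)).
by apply/forall_inP => y yC; apply: h.
Qed.

Lemma chain0 : chain set0.
Proof. by apply/chainP => x y; rewrite inE. Qed.

Lemma chainU1 C x : chain C -> {in C, forall y, x >=< y} -> chain (x |: C).
Proof.
move=> /chainP cC h; apply/chainP => y z /setU1P[->|yC] /setU1P[->|zC].
- exact: comparablexx.
- exact: h.
- by rewrite comparable_sym; apply: h.
- exact: cC.
Qed.

Lemma chainleP F C :
  reflect (chain C /\ {in C, forall x, x <= F}) (chainle F C).
Proof. by apply: (iffP andP) => -[? /forall_inP ?]. Qed.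

Lemma chainle0 F : chainle F set0.
Proof. by apply/chainleP; split=> [|x]; rewrite ?chain0 ?inE. Qed.

Lemma chainle_top : chainle \top =1 chain.
Proof.
by move=> C; apply/andb_idr => _; apply/forall_inP => x _; exact: lex1.
Qed.

Lemma max_chainle_U1 F C x : maxset (chainle F) C -> x <= F ->
  {in C, forall y, x >=< y} -> x \in C.
Proof.
case/maxsetP=> /chainleP[cC leC] mC xF h.
rewrite -(mC (x |: C)) ?setU11 ?subsetUr //.
apply/chainleP; split; first exact: chainU1.
by move=> y /setU1P[->|/leC].
Qed.

Lemma max_chainle_mem F C : maxset (chainle F) C -> F \in C.
Proof.
move=> mC; apply: (max_chainle_U1 mC) => // y yC.
have /maxsetp/chainleP[_ /(_ y yC) yF] := mC.
by rewrite comparable_sym le_comparable.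
Qed.

Lemma max_chainle_bot F C : maxset (chainle F) C -> \bot \in C.
Proof.
by move=> mC; apply: (max_chainle_U1 mC) => // y yC; rewrite le_comparable.
Qed.

Section Grading.
Variables (r : T -> nat) (rP : is_grading r).

Lemma grading_lt x y : x < y -> (r x < r y)%N.
Proof.
have [m le_m] := ubnP #|proper_section x y|.
elim: m x y le_m => // m IHm x y le_m xy.
have [s0|[z]] := set_0Vmem (proper_section x y).
  by rewrite (rP.2 _ _ xy s0).
rewrite inE => /andP[xz zy].
have sub1 : proper_section x z \proper proper_section x y.
  apply/properP; split.
    by apply/subsetP => t; rewrite !inE => /andP[-> /lt_trans->].
  by exists z; rewrite !inE ?xz ?zy ?ltxx ?andbF.
have sub2 : proper_section z y \proper proper_section x y.
  apply/properP; split.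
    by apply/subsetP => t; rewrite !inE => /andP[/(lt_trans xz)-> ->].
  by exists z; rewrite !inE ?xz ?zy ?ltxx ?andbF.
apply: (@ltn_trans (r z)); apply: IHm => //.
  exact: leq_trans (proper_card sub1) _.
exact: leq_trans (proper_card sub2) _.
Qed.

Lemma grading_le x y : x <= y -> (r x <= r y)%N.
Proof. by rewrite le_eqVlt => /predU1P[->//|/grading_lt/ltnW]. Qed.

Lemma grading_gt0 x : (0 < r x)%N = (x != \bot).
Proof.
have [->|nx] := eqVneq x \bot; first by rewrite rP.1.
by rewrite -rP.1 grading_lt // lt0x.
Qed.

Lemma grading_inj C : chain C -> {in C &, injective r}.
Proof.
move=> /chainP cC x y xC yC rxy.
have := cC x y xC yC; case: (comparableP x y) => // /grading_lt.
  by rewrite rxy ltnn.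
by rewrite rxy ltnn.
Qed.

Lemma grading_card F C : maxset (chainle F) C -> #|C| = (r F).+1.
Proof.
move=> mC; have /maxsetp/chainleP[cC leC] := mC.
have ltr x : x \in C -> (r x < (r F).+1)%N by move=> /leC/grading_le.
have surj j : (j <= r F)%N -> exists2 x, x \in C & r x = j.
  elim: j => [_|j IHj ltj]; first by exists \bot; rewrite ?rP.1 ?(max_chainle_bot mC).
  have [x xC rx] := IHj (ltnW ltj).
  pose above z := (z \in C) && (j < r z)%N.
  have FP : above F by rewrite /above (max_chainle_mem mC).
  case: (arg_minnP r FP) => y /andP[yC jy] miny.
  exists y => //.
  have xy : x < y.
    have := (chainP _ cC) x y xC yC.
    case: (comparableP x y) => // [/grading_lt ryx|exy] _; first by lia.
    by move: jy; rewrite -exy rx ltnn.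
  rewrite -rx; apply: rP.2 => //; apply/setP => z; rewrite [RHS]inE.
  apply/negP; rewrite inE => /andP[xz zy].
  have zC : z \in C.
    apply: (max_chainle_U1 mC); first exact: le_trans (ltW zy) (leC _ yC).
    move=> t tC; have := (chainP _ cC) y t yC tC.
    rewrite /Order.comparable => /orP[yt|ty].
      by rewrite (le_trans (ltW zy) yt).
    have [jt|tj] := ltnP j (r t).
      have := miny t; rewrite /above tC jt => /(_ isT) ryt.
      have -> : t = y by apply: (grading_inj cC) => //; have := grading_le ty; lia.
      by rewrite (ltW zy).
    have := (chainP _ cC) t x tC xC.
    rewrite /Order.comparable => /orP[tx|xt].
      by rewrite (le_trans tx (ltW xz)) orbT.
    have -> : t = x by apply: (grading_inj cC) => //; have := grading_le xt; lia.
    by rewrite (ltW xz) orbT.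
  have := miny z; rewrite /above zC -rx grading_lt // => /(_ isT).
  by have := grading_lt zy; lia.
pose g (x : T) : 'I_(r F).+1 := inord (r x).
have gC : {in C &, injective g}.
  move=> x y xC yC /(congr1 val); rewrite /= !inordK ?ltr //.
  exact: (grading_inj cC).
rewrite -(card_in_imset gC) -[RHS]card_ord -cardsT.
apply: eq_card => j; rewrite inE; apply/imsetP.
have [x xC rx] := surj j (ltn_ord j).
by exists x => //; apply: val_inj; rewrite /= inordK rx.
Qed.

Lemma rank_grading F : rank F = ((r F)%:Z - 1)%R.
Proof.
rewrite /rank; set m := (\max_(C | _) _)%N.
suff -> : m = (r F).+1 by lia.
apply/eqP; rewrite eqn_leq; apply/andP; split.
  apply/bigmax_leqP => C /maxset_exists[E mE CE].
  by rewrite -(grading_card mE) subset_leq_card.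
have [E mE _] := maxset_exists (chainle0 F).
rewrite -(grading_card mE).
rewrite /m; apply: bigop.leq_bigmax_cond; apply: maxsetp mE.
Qed.

Lemma max_chain_card C : maxset chain C -> #|C| = (r \top).+1.
Proof. by rewrite -(maxset_eq C chainle_top) => /grading_card. Qed.

End Grading.

(* Conversely, maximal chains of equal size provide a grading. *)
Lemma grading_of_max_chain n :
  (forall C, maxset chain C -> #|C| = n) -> exists r : T -> nat, is_grading r.
Proof.
move=> sizeC.
pose chainge F C := chain C && [forall x in C, F <= x].
have [D DP] : exists D : T -> {set T}, forall F, maxset (chainge F) (D F).
  have ex F : exists D, maxset (chainge F) D.
    have : chainge F set0.
      by apply/andP; split; [exact: chain0|apply/forall_inP=> x; rewrite inE].
    by case/maxset_exists=> D; exists D.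
  by exists (fun F => xchoose (ex F)) => F; apply: xchooseP.
have DU F x : F <= x -> {in D F, forall y, x >=< y} -> x \in D F.
  move=> Fx h; have /maxsetP[/andP[cD /forall_inP geD] mD] := DP F.
  rewrite -(mD (x |: D F)) ?setU11 ?subsetUr //.
  apply/andP; split; first exact: chainU1.
  by apply/forall_inP => y /setU1P[->|/geD].
have Dge F x : x \in D F -> F <= x.
  by have /maxsetp/andP[_ /forall_inP] := DP F; apply.
have FD F : F \in D F.
  by apply: DU => // y /Dge; apply: le_comparable.
have cardCD F C : maxset (chainle F) C -> (#|C| + #|D F| = n.+1)%N.
  move=> mC; have /maxsetp/chainleP[cC leC] := mC.
  have FC := max_chainle_mem mC.
  have CID : C :&: D F = [set F].
    apply/setP => x; rewrite !inE; apply/andP/eqP => [[/leC xF /Dge Fx]|->//].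
    by apply/eqP; rewrite eq_le xF.
  suff mCD : maxset chain (C :|: D F).
    by rewrite -cardsUI CID cards1 sizeC ?addn1.
  apply/maxsetP; split.
    apply/chainP => x y /setUP[xC|xD] /setUP[yC|yD].
    - exact: (chainP _ cC).
    - by rewrite le_comparable // (le_trans (leC _ xC)) ?Dge.
    - by rewrite comparable_sym le_comparable // (le_trans (leC _ yC)) ?Dge.
    - by have /maxsetp/andP[/chainP cD _] := DP F; apply: cD.
  move=> E /chainP cE sE; apply/eqP; rewrite eqEsubset sE andbT.
  apply/subsetP => x xE; rewrite inE.
  have CE y : y \in C -> y \in E by move=> yC; rewrite (subsetP sE) // inE yC.
  have DE y : y \in D F -> y \in E.
    by move=> yD; rewrite (subsetP sE) // inE yD orbT.
  have := cE x F xE (CE _ FC); rewrite /Order.comparable => /orP[xF|Fx].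
    by rewrite (max_chainle_U1 mC) // => y /CE; apply: cE.
  by rewrite DU ?orbT // => y /DE; apply: cE.
exists (fun F => n - #|D F|)%N; split.
  have [C mC _] := maxset_exists (chainle0 \bot).
  suff C1 : #|C| = 1 by have := cardCD _ _ mC; lia.
  apply/eqP/cards1P; exists \bot; apply/setP => x; rewrite inE.
  apply/idP/eqP => [|->]; last exact: max_chainle_mem mC.
  by have /maxsetp/chainleP[_ leC] := mC => /leC; rewrite lex0 => /eqP.
move=> x y xy s0.
have [C mC _] := maxset_exists (chainle0 x).
have /maxsetp/chainleP[cC leC] := mC.
have yNC : y \notin C.
  by apply/negP => /leC /(lt_le_trans xy); rewrite ltxx.
suff /cardCD : maxset (chainle y) (y |: C).
  have C0 : (0 < #|C|)%N by apply/card_gt0P; exists x; apply: max_chainle_mem mC.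
  by rewrite cardsU1 yNC; have := cardCD _ _ mC; lia.
have leyC z : z \in C -> z <= y by move/leC/le_trans; apply; apply: ltW.
apply/maxsetP; split.
  apply/chainleP; split; last by move=> z /setU1P[->|/leyC].
  by apply: chainU1 => // z /leyC; rewrite comparable_sym; apply: le_comparable.
move=> E /chainleP[/chainP cE leE] sE; apply/eqP; rewrite eqEsubset sE andbT.
have CE z : z \in C -> z \in E by move=> zC; rewrite (subsetP sE) // inE zC orbT.
apply/subsetP => z zE; rewrite !inE.
case: eqVneq => //= zy; have {}zy : z < y by rewrite lt_neqAle zy leE.
have := cE z x zE (CE x (max_chainle_mem mC)); rewrite /Order.comparable.
case/orP=> [zx|]; first by apply: (max_chainle_U1 mC) => // t /CE; apply: cE.
rewrite le_eqVlt => /predU1P[<-|xz]; first exact: max_chainle_mem mC.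
by move/setP/(_ z): s0; rewrite !inE xz zy.
Qed.

Definition is_graded_polytope (r : T -> nat) : Prop :=
  [/\ is_grading r,
      forall F G, F <= G -> (r F + 2 < r G)%N ->
        {in proper_section F G &, forall F' G', connect (section_rel F G) F' G'}
    & forall F G, F <= G -> r G = (r F + 2)%N -> #|proper_section F G| = 2].

Lemma polytope_gradedP :
  (exists n, is_polytope n) <-> (exists r : T -> nat, is_graded_polytope r).
Proof.
split=> [[n [_ sizeC conn diam]]|[r [rP conn diam]]].
  have [r rP] : exists r : T -> nat, is_grading r.
    by apply: (@grading_of_max_chain (absz (n + 2)%R)) => C /sizeC; lia.
  exists r; split=> // F G FG rFG.
    have [|//] := conn F G FG; rewrite !(rank_grading rP); lia.
  by apply: diam => //; rewrite !(rank_grading rP); lia.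
exists ((r \top)%:Z - 1)%R; split.
- by lia.
- by move=> C /(max_chain_card rP) ->; lia.
- move=> F G FG; rewrite !(rank_grading rP).
  have [le2|gt2] := leqP (r G) (r F + 2); first by left; lia.
  by right; apply: conn.
- move=> F G FG; rewrite !(rank_grading rP) => rFG; apply: diam => //; lia.
Qed.

End AbstractPolytope.

Arguments is_polytope {d} T n.
Arguments is_graded_polytope {d T} r.

Section Sections.
Context {d1 d2 : Order.disp_t} {T1 : finTBPOrderType d1} {T2 : finTBPOrderType d2}.

Lemma section_connect_sym d (T : finTBPOrderType d) (F G : T) :
  connect_sym (section_rel F G).
Proof.
apply: sym_connect_sym => x y; rewrite /section_rel /=.
by rewrite comparable_sym andbCA.
Qed.

Lemma section_connect1 d (T : finTBPOrderType d) (F G x y : T) :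
  x \in proper_section F G -> y \in proper_section F G -> x <= y ->
  connect (section_rel F G) x y.
Proof.
move=> xS yS xy; apply: connect1; apply/and3P; split=> //.
exact: le_comparable.
Qed.

Variables (f : T1 -> T2) (F1 G1 : T1) (F2 G2 : T2).
Hypothesis fS : {in proper_section F1 G1, forall x, f x \in proper_section F2 G2}.
Hypothesis f_le :
  {in proper_section F1 G1 &, forall x y, x <= y -> f x <= f y}.

Lemma section_connect x y : connect (section_rel F1 G1) x y ->
  connect (section_rel F2 G2) (f x) (f y).
Proof.
move=> /connectP[p + ->]; elim: p x => [|z p IHp] x /=; first by rewrite connect0.
case/andP=> /and3P[xS zS xz] /IHp; apply: connect_trans.
apply: connect1; apply/and3P; split; [exact: fS..|].
by case/orP: xz => /f_le le; apply/orP; [left|right]; apply: le.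
Qed.

Lemma section_card : {in proper_section F1 G1 &, injective f} ->
  {in proper_section F2 G2, forall y, exists2 x, x \in proper_section F1 G1 & y = f x} ->
  #|proper_section F2 G2| = #|proper_section F1 G1|.
Proof.
move=> injf surj; rewrite -(card_in_imset injf); apply: eq_card => y.
by apply/idP/imsetP => [/surj[x]|[x /fS + ->]//]; exists x.
Qed.

End Sections.

Lemma grading_ex d (T : finTBPOrderType d) (r : T -> nat) (x y : T) :
  is_grading r -> x < y -> r y <> (r x).+1 -> exists z, x < z < y.
Proof.
move=> rP xy nr; have [s0|[z]] := set_0Vmem (proper_section x y).
  by case: nr; apply: rP.2.
by rewrite inE; exists z.
Qed.

Lemma grading_cover d (T : finTBPOrderType d) (r : T -> nat) (x y z : T) :
  is_grading r -> r y = (r x).+1 -> x <= z -> z <= y -> (z == x) || (z == y).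
Proof.
move=> rP rxy xz zy; apply/norP => -[zx zny].
have /(grading_lt rP) : x < z by rewrite lt_neqAle eq_sym zx.
have /(grading_lt rP) : z < y by rewrite lt_neqAle zny.
lia.
Qed.

Lemma rank_le d (T : finTBPOrderType d) (x y : T) :
  x <= y -> (rank x <= rank y)%R.
Proof.
move=> xy; rewrite lerD2r lez_nat; apply/bigmax_leqP => C /chainleP[cC leC].
apply: bigop.leq_bigmax_cond; apply/chainleP; split=> // z /leC zx.
exact: le_trans zx xy.
Qed.

Section Join.
Context {d1 d2 : Order.disp_t} (P : finTBPOrderType d1) (Q : finTBPOrderType d2).
Implicit Types (x y z F G : P *p Q).

Lemma prod_ltE x y :
  (x < y) = (x.1 < y.1) && (x.2 <= y.2) || (x.1 <= y.1) && (x.2 < y.2).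
Proof. exact: preorder.Order.ProdOrder.ltEprod. Qed.

Lemma in_section_fst (a : P) (u v : Q) z :
  (z \in proper_section ((a, u) : P *p Q) (a, v)) =
  (z.1 == a) && (z.2 \in proper_section u v).
Proof.
case: z => b w; rewrite !inE /=.
apply/andP/andP => [[h1 h2]|[/eqP -> /andP[uw wv]]]; last first.
  by rewrite !prod_ltE /= lexx uw wv !orbT.
have ba : b = a.
  move/ltW/andP: (h1) => [/= ab _]; move/ltW/andP: (h2) => [/= ba _].
  by apply/eqP; rewrite eq_le ab ba.
move: h1 h2; rewrite !prod_ltE /= ba eqxx ltxx lexx /=.
by move=> -> ->.
Qed.

Lemma in_section_snd (a : Q) (u v : P) z :
  (z \in proper_section ((u, a) : P *p Q) (v, a)) =
  (z.2 == a) && (z.1 \in proper_section u v).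
Proof.
case: z => w b; rewrite !inE /=.
apply/andP/andP => [[h1 h2]|[/eqP -> /andP[uw wv]]]; last first.
  by rewrite !prod_ltE /= lexx uw wv.
have ba : b = a.
  move/ltW/andP: (h1) => [/= _ ab]; move/ltW/andP: (h2) => [/= _ ba].
  by apply/eqP; rewrite eq_le ab ba.
move: h1 h2; rewrite !prod_ltE /= ba eqxx ltxx lexx /=.
by rewrite !andbT !andbF !orbF => -> ->.
Qed.

Variant prod_le_spec F G : Prop :=
| ProdLeEqFst a u v of F = (a, u) & G = (a, v) & u <= v
| ProdLeEqSnd a u v of F = (u, a) & G = (v, a) & u < v
| ProdLeLt of F.1 < G.1 & F.2 < G.2.

Lemma prod_leP F G : F <= G -> prod_le_spec F G.
Proof.
case: F G => [F1 F2] [G1 G2] /andP[/= le1 le2].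
have [e1|n1] := eqVneq F1 G1; first by apply: (ProdLeEqFst _ _ le2); rewrite ?e1.
have lt1 : F1 < G1 by rewrite lt_neqAle n1.
have [e2|n2] := eqVneq F2 G2; first by apply: (ProdLeEqSnd _ _ lt1); rewrite ?e2.
by apply: ProdLeLt; rewrite //= lt_neqAle n2.
Qed.

Variables (r1 : P -> nat) (r2 : Q -> nat).
Hypotheses (r1P : is_graded_polytope r1) (r2P : is_graded_polytope r2).
Let gr1 : is_grading r1. Proof. by case: r1P. Qed.
Let gr2 : is_grading r2. Proof. by case: r2P. Qed.

Definition join_grading x : nat := r1 x.1 + r2 x.2.

Lemma join_gradingP : is_grading join_grading.
Proof.
split=> [|x y xy]; first by rewrite /join_grading gr1.1 gr2.1.
have := prod_leP (ltW xy); rewrite /join_grading => -[a u v ex ey uv|a u v ex ey uv|lt1 lt2] s0.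
- have {}s0 : proper_section u v = set0.
    apply/setP => w; move/setP/(_ (a, w)): s0.
    by rewrite ex ey in_section_fst eqxx !in_set0.
  move: xy; rewrite ex ey prod_ltE /= ltxx lexx /= => uv'.
  by rewrite (gr2.2 u v) // addnS.
- have {}s0 : proper_section u v = set0.
    apply/setP => w; move/setP/(_ (w, a)): s0.
    by rewrite ex ey in_section_snd eqxx !in_set0.
  by rewrite ex ey /= (gr1.2 u v).
- move/setP/(_ (x.1, y.2)): s0; rewrite !inE !prod_ltE /= !lexx lt1 lt2.
  by rewrite orbT.
Qed.

Lemma join_section_connected F G : F <= G ->
    (join_grading F + 2 < join_grading G)%N ->
  {in proper_section F G &, forall F' G', connect (section_rel F G) F' G'}.
Proof.
rewrite /join_grading => /prod_leP[a u v -> -> uv|a u v -> -> uv|lt1 lt2] /= rFG.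
- move=> [b x] [c y]; rewrite !in_section_fst /=.
  move=> /andP[/eqP -> xS] /andP[/eqP -> yS].
  apply: (section_connect (f := fun w => (a, w) : P *p Q) (F1 := u) (G1 := v)).
  + by move=> w wS; rewrite in_section_fst eqxx.
  + by move=> w t _ _ wt; rewrite Order.ProdOrder.leEprod /= lexx.
  + by case: r2P => _ conn _; apply: conn => //; lia.
- move=> [x b] [y c]; rewrite !in_section_snd /=.
  move=> /andP[/eqP -> xS] /andP[/eqP -> yS].
  apply: (section_connect (f := fun w => (w, a) : P *p Q) (F1 := u) (G1 := v)).
  + by move=> w wS; rewrite in_section_snd eqxx.
  + by move=> w t _ _ wt; rewrite Order.ProdOrder.leEprod /= lexx andbT.
  + by case: r1P => _ conn _; apply: conn => //; [exact: ltW|lia].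
case: F G lt1 lt2 rFG => [F1 F2] [G1 G2] /= lt1 lt2 rFG.
have [le1 le2] := (ltW lt1, ltW lt2).
set S := proper_section _ _.
pose c x y := connect (section_rel ((F1, F2) : P *p Q) (G1, G2)) x y.
have cC x y : c x y = c y x by apply: section_connect_sym.
have c_trans y x z : c x y -> c y z -> c x z by apply: connect_trans.
have step (a a' : P) (b b' : Q) : (a, b) \in S -> (a', b') \in S ->
    a <= a' -> b <= b' -> c (a, b) (a', b').
  move=> S1 S2 ab ab'; apply: section_connect1 => //.
  by rewrite Order.ProdOrder.leEprod /= ab.
have inS (a : P) (b : Q) : F1 <= a <= G1 -> F2 <= b <= G2 ->
    (F1 < a) || (F2 < b) -> (a < G1) || (b < G2) -> (a, b) \in S.
  move=> /andP[a1 a2] /andP[b1 b2] ab ab'.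
  rewrite inE !prod_ltE /= a1 a2 b1 b2 !andbT.
  by rewrite ab.
have pS : (G1, F2) \in S by apply: inS; rewrite ?lexx ?le1 ?le2 ?lt1 ?lt2 ?orbT.
have qS : (F1, G2) \in S by apply: inS; rewrite ?lexx ?le1 ?le2 ?lt1 ?lt2 ?orbT.
have pq : c (G1, F2) (F1, G2).
  have [r1G|r1G] := eqVneq (r1 G1) (r1 F1).+1.
    have [|y /andP[Fy yG]] := @grading_ex _ _ r2 F2 G2 gr2 lt2.
      by lia.
    have S1 : (G1, y) \in S.
      by apply: inS; rewrite ?lexx ?le1 ?Fy ?yG ?ltW ?orbT.
    have S2 : (F1, y) \in S.
      by apply: inS; rewrite ?lexx ?le1 ?Fy ?yG ?ltW ?orbT.
    apply: (c_trans (G1, y)); first by apply: step; rewrite ?lexx ?ltW.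
    apply: (c_trans (F1, y)); first by rewrite cC; apply: step; rewrite ?lexx.
    by apply: step; rewrite ?lexx ?ltW.
  have [|y /andP[Fy yG]] := @grading_ex _ _ r1 F1 G1 gr1 lt1.
    exact/eqP.
  have S1 : (y, F2) \in S.
    by apply: inS; rewrite ?lexx ?le2 ?Fy ?yG ?ltW ?orbT.
  have S2 : (y, G2) \in S.
    by apply: inS; rewrite ?lexx ?le2 ?Fy ?yG ?ltW ?orbT.
  apply: (c_trans (y, F2)); first by rewrite cC; apply: step; rewrite ?lexx ?ltW.
  apply: (c_trans (y, G2)); first by apply: step; rewrite ?lexx.
  by rewrite cC; apply: step; rewrite ?lexx ?ltW.
suff cp x : x \in S -> c x (G1, F2).
  by move=> x y /cp cx /cp; rewrite cC; apply: c_trans cx.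
case: x => a b xS; have := xS; rewrite inE => /andP[Fx xG].
have /andP[/= Fa Fb] := ltW Fx; have /andP[/= aG bG] := ltW xG.
have [ea|na] := eqVneq a F1.
  rewrite cC; apply: c_trans pq _; rewrite cC; apply: step => //.
  by rewrite ea.
have lt_a : F1 < a by rewrite lt_neqAle eq_sym na.
have S1 : (a, F2) \in S by apply: inS; rewrite ?lexx ?Fa ?aG ?lt_a ?lt2 ?orbT // ltW.
apply: (c_trans (a, F2)); first by rewrite cC; apply: step; rewrite ?lexx.
by apply: step.
Qed.

Lemma join_diamond F G : F <= G -> join_grading G = (join_grading F + 2)%N ->
  #|proper_section F G| = 2.
Proof.
rewrite /join_grading => /prod_leP[a u v -> -> uv|a u v -> -> uv|lt1 lt2] /= rFG.
- rewrite (@section_card _ _ _ _ (fun w => (a, w) : P *p Q) u v).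
  + by case: r2P => _ _; apply=> //; lia.
  + by move=> w wS; rewrite in_section_fst eqxx.
  + by move=> w t _ _ [].
  + move=> [b w]; rewrite in_section_fst => /andP[/eqP/= -> wS].
    by exists w.
- rewrite (@section_card _ _ _ _ (fun w => (w, a) : P *p Q) u v).
  + by case: r1P => _ _; apply=> //; [exact: ltW|lia].
  + by move=> w wS; rewrite in_section_snd eqxx.
  + by move=> w t _ _ [].
  + move=> [w b]; rewrite in_section_snd => /andP[/eqP/= -> wS].
    by exists w.
case: F G lt1 lt2 rFG => [F1 F2] [G1 G2] /= lt1 lt2 rFG.
have [r1lt r2lt] := (grading_lt gr1 lt1, grading_lt gr2 lt2).
have -> : proper_section ((F1, F2) : P *p Q) (G1, G2) = [set (G1, F2); (F1, G2)].
  apply/setP => -[a b]; rewrite !inE.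
  apply/idP/orP => [/andP[Fx xG]|[]/eqP[-> ->]]; last 2 first.
  - by rewrite !prod_ltE /= !lexx lt1 lt2 orbT.
  - by rewrite !prod_ltE /= !lexx lt1 lt2 orbT.
  have /andP[/= Fa Fb] := ltW Fx; have /andP[/= aG bG] := ltW xG.
  have r1e : r1 G1 = (r1 F1).+1 by lia.
  have r2e : r2 G2 = (r2 F2).+1 by lia.
  have /orP[/eqP ea|/eqP ea] := grading_cover gr1 r1e Fa aG;
    have /orP[/eqP eb|/eqP eb] := grading_cover gr2 r2e Fb bG;
    move: Fx xG; rewrite ea eb ?ltxx // => _ _; by [left|right].
by rewrite cards2 xpair_eqE (gt_eqF lt1).
Qed.

Lemma join_graded : is_graded_polytope join_grading.
Proof.
split; [exact: join_gradingP | exact: join_section_connected | exact: join_diamond].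
Qed.

End Join.

Section Cartesian.
Context {d1 d2 : Order.disp_t} (P : finTBPOrderType d1) (Q : finTBPOrderType d2).

Definition in_cartesian (x : P *p Q) : bool :=
  ((0 <= rank x.1) && (0 <= rank x.2))%R || (x == \bot).

Record cartesian : predArgType := CartesianFace {
  cartesian_val :> P *p Q;
  _ : in_cartesian cartesian_val
}.

HB.instance Definition _ := [isSub for cartesian_val].
#[hnf] HB.instance Definition _ := [Finite of cartesian by <:].
#[hnf] HB.instance Definition _ := [SubChoice_isSubPOrder of cartesian by <:
  with Order.prod_display d1 d2].

Implicit Types x y z F G : cartesian.

Lemma cartesian_leE x y : (x <= y) = (val x <= val y).
Proof. by []. Qed.

Lemma cartesian_ltE x y : (x < y) = (val x < val y).
Proof. by []. Qed.

Lemma in_cartesian_bot : in_cartesian \bot.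
Proof. by rewrite /in_cartesian eqxx orbT. Qed.

Definition cartesian_bot : cartesian := CartesianFace in_cartesian_bot.
Definition cartesian_top : cartesian := insubd cartesian_bot \top.

Lemma cartesian_bot_le x : cartesian_bot <= x.
Proof. by rewrite cartesian_leE le0x. Qed.

Lemma cartesian_le_top x : x <= cartesian_top.
Proof.
rewrite cartesian_leE val_insubd; case: ifPn => [_|]; first exact: lex1.
case: x => x /= /orP[/andP[h1 h2]|/eqP -> _]; last exact: le0x.
move/negP; case; apply/orP; left; apply/andP; split.
  exact: le_trans h1 (rank_le (lex1 _)).
exact: le_trans h2 (rank_le (lex1 _)).
Qed.

HB.instance Definition _ :=
  Order.hasBottom.Build (Order.prod_display d1 d2) cartesian cartesian_bot_le.
HB.instance Definition _ :=
  Order.hasTop.Build (Order.prod_display d1 d2) cartesian cartesian_le_top.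

Variables (r1 : P -> nat) (r2 : Q -> nat).
Hypotheses (r1P : is_graded_polytope r1) (r2P : is_graded_polytope r2).
Let gr1 : is_grading r1. Proof. by case: r1P. Qed.
Let gr2 : is_grading r2. Proof. by case: r2P. Qed.

Definition cartesian_grading x : nat := (join_grading r1 r2 (val x)).-1.

Let to_cartesian (x : P *p Q) : cartesian := insubd cartesian_bot x.

Lemma in_cartesianE (x : P *p Q) :
  in_cartesian x = ((x.1 != \bot) && (x.2 != \bot)) || (x == \bot).
Proof.
rewrite /in_cartesian (rank_grading gr1) (rank_grading gr2).
rewrite -(grading_gt0 gr1) -(grading_gt0 gr2) !subr_ge0.
by rewrite !lez_nat.
Qed.

Lemma val_cartesian_bot : val (\bot : cartesian) = \bot.
Proof. by []. Qed.

Lemma val_to_cartesian (x : P *p Q) :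
  x.1 != \bot -> x.2 != \bot -> val (to_cartesian x) = x.
Proof. by move=> h1 h2; rewrite val_insubd in_cartesianE h1 h2. Qed.

Lemma cartesian_nbot x : x != \bot ->
  ((val x).1 != \bot) && ((val x).2 != \bot).
Proof.
move=> xN; have := valP x; rewrite in_cartesianE => /orP[//|/eqP xb].
by case/eqP: xN; apply: val_inj.
Qed.

Lemma cartesian_gt0 (x : P *p Q) : x.1 != \bot -> x.2 != \bot ->
  [/\ 0 < r1 x.1, 0 < r2 x.2 & 0 < join_grading r1 r2 x]%N.
Proof.
rewrite /join_grading -(grading_gt0 gr1) -(grading_gt0 gr2) => h1 h2.
by split=> //; lia.
Qed.

Lemma cartesian_gradingE x : x != \bot ->
  join_grading r1 r2 (val x) = (cartesian_grading x).+1.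
Proof.
move=> /cartesian_nbot/andP[h1 h2].
by rewrite /cartesian_grading; have [_ _ /prednK->] := cartesian_gt0 h1 h2.
Qed.

Lemma ge_nbot F (x : P *p Q) : F != \bot -> val F <= x ->
  (x.1 != \bot) && (x.2 != \bot).
Proof.
move=> /cartesian_nbot; rewrite -!lt0x => /andP[h1 h2] /andP[/= le1 le2].
by rewrite (lt_le_trans h1 le1) (lt_le_trans h2 le2).
Qed.

Lemma in_cartesian_section F G (x : P *p Q) : F != \bot ->
  x \in proper_section (val F) (val G) -> to_cartesian x \in proper_section F G.
Proof.
move=> FN; rewrite !inE => /andP[Fx xG].
have /andP[h1 h2] := ge_nbot FN (ltW Fx).
by rewrite !cartesian_ltE val_to_cartesian // Fx.
Qed.

Lemma val_cartesian_section F G x :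
  x \in proper_section F G -> val x \in proper_section (val F) (val G).
Proof. by rewrite !inE. Qed.

Lemma in_cartesian_section0 G a b : a != \bot -> b != \bot ->
  (to_cartesian (a, b) \in proper_section \bot G) = (((a, b) : P *p Q) < val G).
Proof.
move=> aN bN; rewrite inE cartesian_ltE [in X in _ && X]cartesian_ltE.
rewrite val_to_cartesian // andb_idl // => _.
by rewrite val_cartesian_bot lt0x; apply: contraNneq aN => -[->].
Qed.

Lemma to_cartesian_le (x y : P *p Q) :
  x.1 != \bot -> x.2 != \bot -> x <= y -> to_cartesian x <= to_cartesian y.
Proof.
move=> h1 h2 xy; have /andP[le1 le2] := xy.
rewrite cartesian_leE !val_to_cartesian // -lt0x.
  by apply: lt_le_trans le1; rewrite lt0x.
by apply: lt_le_trans le2; rewrite lt0x.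
Qed.

Lemma cartesian_section0P G x : x \in proper_section \bot G ->
  exists a b, [/\ x = to_cartesian (a, b), a != \bot, b != \bot,
    a <= (val G).1 & b <= (val G).2] /\ ((a, b) : P *p Q) < val G.
Proof.
rewrite inE lt0x => /andP[/cartesian_nbot]; case E : (val x) => [a b] /=.
case/andP=> aN bN; rewrite cartesian_ltE E => lt_x; exists a, b; split=> //.
have /andP[-> ->] := ltW lt_x; split=> //.
by apply: val_inj; rewrite val_to_cartesian.
Qed.

(* Sections above 0 whose upper end has a vertex as one of its components. *)
Lemma cartesian_section0_fst G (a : P) (c : Q) :
    val G = (a, c) -> r1 a = 1%N -> c != \bot ->
  [/\ {in proper_section \bot c,
         forall b, to_cartesian (a, b) \in proper_section \bot G},
      {in proper_section \bot c &, forall b b', b <= b' ->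
         to_cartesian (a, b) <= to_cartesian (a, b')},
      {in proper_section \bot c &, injective (fun b => to_cartesian (a, b))} &
      {in proper_section \bot G, forall x, exists2 b,
         b \in proper_section \bot c & x = to_cartesian (a, b)}].
Proof.
move=> GE ra cN.
have aN : a != \bot by rewrite -(grading_gt0 gr1) ra.
split.
- move=> b; rewrite inE lt0x => /andP[bN bc].
  by rewrite in_cartesian_section0 // GE prod_ltE /= lexx bc orbT.
- move=> b b' + _ bb'; rewrite inE lt0x => /andP[bN _].
  by apply: to_cartesian_le => //; rewrite Order.ProdOrder.leEprod /= lexx.
- move=> b b'; rewrite !inE !lt0x => /andP[bN _] /andP[b'N _] /(congr1 val).
  by rewrite !val_to_cartesian // => -[].
- move=> x /cartesian_section0P[a' [b []]]; rewrite GE /=.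
  move=> [-> a'N bN a'a bc] lt_ab.
  have ra' : r1 a = (r1 \bot).+1 by rewrite gr1.1.
  have /orP[|/eqP ea] := grading_cover gr1 ra' (le0x _) a'a.
    by rewrite (negPf a'N).
  subst a'; exists b => //; rewrite inE lt0x bN /=.
  by move: lt_ab; rewrite prod_ltE /= ltxx lexx.
Qed.

Lemma cartesian_section0_snd G (c : P) (b : Q) :
    val G = (c, b) -> r2 b = 1%N -> c != \bot ->
  [/\ {in proper_section \bot c,
         forall a, to_cartesian (a, b) \in proper_section \bot G},
      {in proper_section \bot c &, forall a a', a <= a' ->
         to_cartesian (a, b) <= to_cartesian (a', b)},
      {in proper_section \bot c &, injective (fun a => to_cartesian (a, b))} &
      {in proper_section \bot G, forall x, exists2 a,
         a \in proper_section \bot c & x = to_cartesian (a, b)}].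
Proof.
move=> GE rb cN.
have bN : b != \bot by rewrite -(grading_gt0 gr2) rb.
split.
- move=> a; rewrite inE lt0x => /andP[aN ac].
  by rewrite in_cartesian_section0 // GE prod_ltE /= lexx ac.
- move=> a a' + _ aa'; rewrite inE lt0x => /andP[aN _].
  by apply: to_cartesian_le => //; rewrite Order.ProdOrder.leEprod /= lexx andbT.
- move=> a a'; rewrite !inE !lt0x => /andP[aN _] /andP[a'N _] /(congr1 val).
  by rewrite !val_to_cartesian // => -[].
- move=> x /cartesian_section0P[a [b' []]]; rewrite GE /=.
  move=> [-> aN b'N ac b'b] lt_ab.
  have rb' : r2 b = (r2 \bot).+1 by rewrite gr2.1.
  have /orP[|/eqP eb] := grading_cover gr2 rb' (le0x _) b'b.
    by rewrite (negPf b'N).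
  subst b'; exists a => //; rewrite inE lt0x aN /=.
  by move: lt_ab; rewrite prod_ltE /= ltxx lexx andbT andbF orbF.
Qed.

Lemma cartesian_gradingP : is_grading cartesian_grading.
Proof.
split; first by rewrite /cartesian_grading /join_grading /= gr1.1 gr2.1.
move=> x y xy s0; have yN : y != \bot by rewrite -lt0x (le_lt_trans _ xy).
have [exb|xN] := eqVneq x \bot; last first.
  apply: succn_inj; rewrite -!cartesian_gradingE //.
  apply: (join_gradingP r1P r2P).2 => //; apply/setP => z; rewrite [RHS]inE.
  by apply/negP => /(in_cartesian_section xN); rewrite s0 inE.
have /andP[y1N y2N] := cartesian_nbot yN.
case E : (val y) y1N y2N => [a b] /= aN bN.
have r1a : r1 a = 1%N.
  have [//|/eqP r1a] := eqVneq (r1 a) 1%N.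
  have [||c /andP[c0 ca]] := @grading_ex _ _ r1 \bot a gr1;
    rewrite ?lt0x ?gr1.1 //.
  move/setP/(_ (to_cartesian (c, b))): s0.
  by rewrite exb in_cartesian_section0 -?lt0x // ?lt0x // E prod_ltE /= ca lexx inE.
have r2b : r2 b = 1%N.
  have [//|/eqP r2b] := eqVneq (r2 b) 1%N.
  have [||c /andP[c0 cb]] := @grading_ex _ _ r2 \bot b gr2;
    rewrite ?lt0x ?gr2.1 //.
  move/setP/(_ (to_cartesian (a, c))): s0.
  by rewrite exb in_cartesian_section0 -?lt0x // ?lt0x // E prod_ltE /= cb lexx orbT inE.
by rewrite /cartesian_grading exb E /join_grading /= r1a r2b gr1.1 gr2.1.
Qed.

Lemma cartesian_section_connected F G : F <= G ->
    (cartesian_grading F + 2 < cartesian_grading G)%N ->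
  {in proper_section F G &, forall F' G', connect (section_rel F G) F' G'}.
Proof.
move=> FG rFG.
have GN : G != \bot.
  by apply: contraTneq rFG => ->; rewrite (cartesian_gradingP.1).
have [F0|FN] := eqVneq F \bot; last first.
  have rFG' : (join_grading r1 r2 (val F) + 2 < join_grading r1 r2 (val G))%N.
    by rewrite !cartesian_gradingE.
  move=> x y xS yS.
  have := join_section_connected r1P r2P FG rFG'
    (val_cartesian_section xS) (val_cartesian_section yS).
  move/(section_connect (f := to_cartesian) (F2 := F) (G2 := G)).
  rewrite /to_cartesian !valKd; apply.
    by move=> z; apply: in_cartesian_section.
  move=> z t; rewrite inE => /andP[/ltW/(ge_nbot FN)/andP[z1 z2] _] _.
  exact: to_cartesian_le.
rewrite F0; case E : (val G) => [a b].
have := cartesian_gradingE GN; rewrite E /join_grading /= => rG.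
have /andP[] := cartesian_nbot GN; rewrite E /= => aN bN.
have rG2 : (2 < cartesian_grading G)%N.
  by move: rFG; rewrite F0 (cartesian_gradingP.1).
have [r1a|r1a] := eqVneq (r1 a) 1%N.
  have [fS f_le _ surj] := @cartesian_section0_fst G a b E r1a bN.
  move=> _ _ /surj[c cS ->] /surj[c' c'S ->].
  apply: (section_connect (f := fun b => to_cartesian (a, b)) fS f_le).
  by case: r2P => _ conn _; apply: conn => //; rewrite gr2.1; lia.
have [r2b|r2b] := eqVneq (r2 b) 1%N.
  have [fS f_le _ surj] := @cartesian_section0_snd G a b E r2b aN.
  move=> _ _ /surj[c cS ->] /surj[c' c'S ->].
  apply: (section_connect (f := fun a => to_cartesian (a, b)) fS f_le).
  by case: r1P => _ conn _; apply: conn => //; rewrite gr1.1; lia.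
have [||a0] := @grading_ex _ _ r1 \bot a gr1; rewrite ?lt0x ?gr1.1 //; first exact/eqP.
move=> /andP[a0N a0a].
have [||b0] := @grading_ex _ _ r2 \bot b gr2; rewrite ?lt0x ?gr2.1 //; first exact/eqP.
move=> /andP[b0N b0b].
pose c x y := connect (section_rel (\bot : cartesian) G) x y.
have cC x y : c x y = c y x by apply: section_connect_sym.
have c_trans y x z : c x y -> c y z -> c x z by apply: connect_trans.
pose ok (x : P) (y : Q) :=
  [&& x != \bot, y != \bot, x <= a, y <= b & (x < a) || (y < b)].
have inS (x : P) (y : Q) : ok x y -> to_cartesian (x, y) \in proper_section \bot G.
  move=> /and5P[xN yN xa yb xy].
  by rewrite in_cartesian_section0 // E prod_ltE /= xa yb !andbT.
have step (x x' : P) (y y' : Q) : ok x y -> ok x' y' -> x <= x' -> y <= y' ->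
    c (to_cartesian (x, y)) (to_cartesian (x', y')).
  move=> o1 o2 xx' yy'; apply: section_connect1; [exact: inS..|].
  by case/and5P: o1 => xN yN _ _ _; apply: to_cartesian_le => //; apply/andP.
suff ca x : x \in proper_section \bot G -> c x (to_cartesian (a, b0)).
  by move=> x y /ca cx /ca; rewrite cC; apply: c_trans cx.
case/cartesian_section0P => x1 [x2 []]; rewrite E /=.
move=> [-> x1N x2N x1a x2b] lt_x.
have ok_a0 (y : Q) : y != \bot -> y <= b -> ok a0 y.
  by move=> yN yb; rewrite /ok a0N yN ltW // a0a yb.
have ok_b0 (x' : P) : x' != \bot -> x' <= a -> ok x' b0.
  by move=> xN xa; rewrite /ok xN b0N xa b0b orbT ltW.
have [e2|n2] := eqVneq x2 b.
  have lt1 : x1 < a by move: lt_x; rewrite e2 prod_ltE /= ltxx lexx andbT andbF orbF.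
  apply: (c_trans (to_cartesian (x1, b0))).
    rewrite cC; apply: step; rewrite ?ok_b0 // /ok ?x1N ?x2N ?x1a ?x2b ?lt1 //.
    by rewrite e2 ltW.
  by apply: step; rewrite ?ok_b0.
have lt2 : x2 < b by rewrite lt_neqAle n2.
have ok_2 (x' : P) : x' != \bot -> x' <= a -> ok x' x2.
  by move=> xN xa; rewrite /ok xN xa x2N x2b lt2 orbT.
apply: (c_trans (to_cartesian (a, x2))); first by apply: step; rewrite ?ok_2.
apply: (c_trans (to_cartesian (a0, x2))).
  by rewrite cC; apply: step; rewrite ?ok_2 // ltW.
apply: (c_trans (to_cartesian (a0, b))).
  by apply: step; rewrite ?ok_a0.
apply: (c_trans (to_cartesian (a0, b0))).
  by rewrite cC; apply: step; rewrite ?ok_a0 // ltW.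
by apply: step; rewrite ?ok_b0 // ltW.
Qed.

Lemma cartesian_diamond F G : F <= G ->
    cartesian_grading G = (cartesian_grading F + 2)%N ->
  #|proper_section F G| = 2.
Proof.
move=> FG rFG.
have GN : G != \bot.
  by apply: contra_eqN rFG => /eqP ->; rewrite (cartesian_gradingP.1) addn2.
have [F0|FN] := eqVneq F \bot; last first.
  rewrite (@section_card _ _ _ _ to_cartesian (val F) (val G)).
  - by apply: (join_diamond r1P r2P) => //; rewrite !cartesian_gradingE // rFG.
  - by move=> z; apply: in_cartesian_section.
  - move=> z t; rewrite !inE => /andP[/ltW/(ge_nbot FN)/andP[z1 z2] _].
    move=> /andP[/ltW/(ge_nbot FN)/andP[t1 t2] _] /(congr1 val).
    by rewrite !val_to_cartesian.
  - move=> x xS; exists (val x); first exact: val_cartesian_section.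
    by rewrite /to_cartesian valKd.
rewrite F0; case E : (val G) => [a b].
have := cartesian_gradingE GN; rewrite E /join_grading /= => rG.
have /andP[] := cartesian_nbot GN; rewrite E /= => aN bN.
have [r1a r2b _] := @cartesian_gt0 (a, b) aN bN; rewrite /= in r1a r2b.
move: rFG; rewrite F0 (cartesian_gradingP.1) => rG2.
have [r1a1|r1a1] := eqVneq (r1 a) 1%N.
  have [fS _ finj surj] := @cartesian_section0_fst G a b E r1a1 bN.
  rewrite (section_card fS finj surj).
  by case: r2P => _ _; apply=> //=; rewrite gr2.1; lia.
have r2b1 : r2 b = 1%N by lia.
have [fS _ finj surj] := @cartesian_section0_snd G a b E r2b1 aN.
rewrite (section_card fS finj surj).
by case: r1P => _ _; apply=> //=; rewrite gr1.1; lia.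
Qed.

Lemma cartesian_graded : is_graded_polytope cartesian_grading.
Proof.
split; [exact: cartesian_gradingP | exact: cartesian_section_connected |].
exact: cartesian_diamond.
Qed.

End Cartesian.

Record polytope := Polytope {
  face_display : Order.disp_t;
  faces :> finTBPOrderType face_display;
  polytopeP : exists n, is_polytope faces n
}.

Lemma point_graded : is_graded_polytope (nat_of_bool : bool -> nat).
Proof.
split.
- by split=> // -[] [].
- by move=> [] [].
- by move=> [] [].
Qed.

(* The polytope pt of rank 0; its two faces are 0 and 1. *)
Definition point : polytope :=
  Polytope (polytope_gradedP.2 (ex_intro _ _ point_graded)).

Lemma join_polytopeP (P Q : polytope) :
  exists n, is_polytope (P *p Q)%type n.
Proof.
have [r1 r1P] := polytope_gradedP.1 (polytopeP P).
have [r2 r2P] := polytope_gradedP.1 (polytopeP Q).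
by apply/polytope_gradedP; exists (join_grading r1 r2); apply: join_graded.
Qed.

Definition join (P Q : polytope) : polytope := Polytope (join_polytopeP P Q).

Lemma cartesian_polytopeP (P Q : polytope) :
  exists n, is_polytope (cartesian P Q) n.
Proof.
have [r1 r1P] := polytope_gradedP.1 (polytopeP P).
have [r2 r2P] := polytope_gradedP.1 (polytopeP Q).
apply/polytope_gradedP; exists (@cartesian_grading _ _ P Q r1 r2).
exact: cartesian_graded.
Qed.

Definition product (P Q : polytope) : polytope :=
  Polytope (cartesian_polytopeP P Q).

(* The polytope I of rank 1; its four faces are 0, two vertices and 1. *)
Definition edge : polytope := join point point.

Lemma rank_point : rank (\top : point) = 0%R.
Proof. by case: point_graded => h _ _; rewrite (rank_grading h). Qed.

Lemma rank_edge : rank (\top : edge) = 1%R.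
Proof.
have h := join_gradingP point_graded point_graded.
by rewrite (rank_grading h).
Qed.

Section Automorphisms.
Variable P : polytope.

Definition polytope_aut : {set {perm P}} :=
  [set f : {perm P} | [forall F, forall G, (f F <= f G) == (F <= G)]].

Lemma polytope_autP (f : {perm P}) :
  reflect (forall F G, (f F <= f G) = (F <= G)) (f \in polytope_aut).
Proof.
rewrite inE; apply: (iffP forallP) => [h F G|h F].
  by apply/eqP; apply: (forallP (h F)).
by apply/forallP => G; rewrite h.
Qed.

Lemma group_set_polytope_aut : group_set polytope_aut.
Proof.
apply/group_setP; split=> [|f g /polytope_autP hf /polytope_autP hg].
  by apply/polytope_autP => F G; rewrite !perm1.
by apply/polytope_autP => F G; rewrite !permM hg hf.
Qed.

Canonical polytope_aut_group := Group group_set_polytope_aut.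

End Automorphisms.

Section SignedPermutations.
Variable k : nat.
Implicit Types (v : 'rV['Z_2]_k) (s : {perm 'I_k}).

(* Permutations compose left to right, so the inverse makes this a right
   action. *)
Definition permute_coord v s : 'rV['Z_2]_k := (\row_i v ord0 (s^-1%g i))%R.

Lemma permute_coord1 : permute_coord^~ 1%g =1 id.
Proof. by move=> v; apply/rowP => i; rewrite mxE invg1 perm1. Qed.

Lemma permute_coordM v : act_morph permute_coord v.
Proof. by move=> s t; apply/rowP => i; rewrite !mxE invMg permM. Qed.

Canonical permute_coord_action := TotalAction permute_coord1 permute_coordM.

Lemma permute_coord_is_groupAction :
  is_groupAction [set: 'rV['Z_2]_k] permute_coord_action.
Proof.
move=> s _; rewrite inE; apply/andP; split.
  by apply/subsetP => v; rewrite inE.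
by apply/morphicP => v w _ _; rewrite !actpermE; apply/rowP => i; rewrite !mxE.
Qed.

Canonical permute_coord_groupAction := GroupAction permute_coord_is_groupAction.

(* (Z/2)^k ><| Sym(k), where (Z/2)^k is the additive group of 'rV['Z_2]_k. *)
Definition signed_perm : finGroupType :=
  sdprod_groupType permute_coord_groupAction.

End SignedPermutations.

Definition sym (k : nat) : finGroupType := {perm 'I_k}.

(* The direct product, None being the symbol null. *)
Definition null_prod (A : option finGroupType) (B : finGroupType) : finGroupType :=
  if A is Some A then (A * B)%type else B.

(* Construction sequences, the last operation being outermost. *)
Inductive construction :=
| Edge
| TimesI of construction
| JoinPt of construction.

Fixpoint polytope_of (c : construction) : polytope :=
  match c with
  | Edge => edge
  | TimesI c => product (polytope_of c) edge
  | JoinPt c => join (polytope_of c) point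
  end.

Inductive prod_kind := kind_cartesian | kind_join.

Record attached_data := Attached {
  group_A : option finGroupType;
  int_k : nat;
  kind_prod : prod_kind
}.

Fixpoint attached (c : construction) : attached_data :=
  match c with
  | Edge => Attached None 1 kind_cartesian
  | JoinPt Edge => Attached None 3 kind_join
  | TimesI c =>
      let: Attached A k prod := attached c in
      match prod with
      | kind_cartesian => Attached A k.+1 kind_cartesian
      | kind_join => Attached (Some (null_prod A (sym k))) 1 kind_cartesian
      end
  | JoinPt c =>
      let: Attached A k prod := attached c in
      match prod with
      | kind_cartesian => Attached (Some (null_prod A (signed_perm k))) 1 kind_join
      | kind_join => Attached A k.+1 kind_join
      end
  end.

(* Main.v *)
Require Import Defs.
From mathcomp Require Import all_boot all_order all_fingroup all_algebra.

Set Implicit Arguments.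
Unset Strict Implicit.
Unset Printing Implicit Defensive.

Import Order.TTheory.

(** The polytopes of the process are powers in disguise.  For a set [X] let [W]
    be the antichain [X] with a top element added.  As a poset, the
    two-element polytope [pt] is [W] for the one-element [X], and the
    nonempty faces of the edge [I] form [W] for the two-element [X].  So [k]
    successive operations [*pt] replace the poset of faces [S] by [S * W^k], and
    [k] successive operations [*I] do the same to the poset of nonempty faces.
    Both halves of the statement therefore become instances of one claim: if [S]
    has a top and does not itself have a factor [W], then
    Aut(S * W^k) = Aut(S) * Aut(W^k).

    The claim rests on the facets of [S * W^k], the coatoms whose [S]-component
    is the top and exactly one of whose other components is not.  Suppose that
    an automorphism permutes them.  Two distinct facets have the same index
    exactly when they have no common lower bound, so the automorphism induces a
    permutation of the indices.  The [W^k]-component of an element is read off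
    the facets above it, and the [S]-component off the least element above it
    that is below no facet; so the automorphism acts separately on [S] and on
    [W^k] ([aut_prod_shape], [isog_prod_aut]).

    It remains to recognize the facets by a property that is invariant under
    automorphisms and that no element of [S] has.  For joins, a facet is an
    element [c] such that the elements not below [c] have a least element
    ([splits_facet]); in a prism over a polytope of positive rank no element has
    this property ([prism_nosplit]).  For Cartesian products, a facet is a
    coatom that has no common lower bound with some other coatom
    ([coatom_facet_aut]); any two coatoms of a pyramid over a polytope of
    positive rank have a nonempty common face ([pyramid_meet]).

    The theorem follows by induction on the construction sequence: the invariant
    [structured] records the factor [S], whose automorphism group is the attached
    group [A], and the exponent is the attached integer.  When the operation
    changes, the whole current polytope becomes the new [S]. *)

(** * Automorphism groups of finite relations *)

Section RelAut.
Variables (T : finType) (r : rel T).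

Definition rel_aut : {set {perm T}} :=
  [set f : {perm T} | [forall x, forall y, r (f x) (f y) == r x y]].

Lemma rel_autP (f : {perm T}) :
  reflect (forall x y, r (f x) (f y) = r x y) (f \in rel_aut).
Proof.
rewrite inE; apply: (iffP forallP) => [h x y|h x].
  by apply/eqP; apply: (forallP (h x)).
by apply/forallP => y; rewrite h.
Qed.

Lemma group_set_rel_aut : group_set rel_aut.
Proof.
apply/group_setP; split=> [|f g /rel_autP hf /rel_autP hg].
  by apply/rel_autP => x y; rewrite !perm1.
by apply/rel_autP => x y; rewrite !permM hg hf.
Qed.

Canonical rel_aut_group := Group group_set_rel_aut.

End RelAut.

Lemma isog_of_fun (gT rT : finGroupType) (G : {group gT}) (H : {group rT})
    (h : gT -> rT) :
    {in G &, {morph h : x y / (x * y)%g}} -> {in G &, injective h} ->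
    h @: G = H -> G \isog H.
Proof.
move=> hM hI hG; apply/isogP; exists (Morphism hM).
  by apply/injmP.
by rewrite morphimEdom.
Qed.

Section Embedding.
Variables (P : polytope) (T : finType) (r : rel T) (g : T -> P).
Hypothesis g_le : forall x y, (g x <= g y)%O = r x y.
Hypothesis g_codom : forall F : P, F != \bot%O -> exists x, F = g x.

Hypothesis g_inj : injective g.

Let ext_fun (f : {perm T}) (F : P) : P :=
  if [pick x | F == g x] is Some x then g (f x) else F.

Let ext_funE f x : ext_fun f (g x) = g (f x).
Proof.
rewrite /ext_fun; case: pickP => [y /eqP/g_inj->//|/(_ x)].
by rewrite eqxx.
Qed.

Let ext_fun_out f F : (forall x, F != g x) -> ext_fun f F = F.
Proof.
by move=> h; rewrite /ext_fun; case: pickP => // x; rewrite (negPf (h x)).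
Qed.

Variant range_spec (F : P) : Type :=
| RangeIn x of F = g x
| RangeOut of F = \bot%O & (forall x, g x != \bot%O).

Let rangeP F : range_spec F.
Proof.
case: (pickP [pred x | F == g x]) => [x /eqP|h]; first exact: RangeIn.
have F0 : F = \bot%O.
  by apply/eqP; apply: contraT => /g_codom[x e]; have := h x; rewrite /= e eqxx.
by apply: RangeOut => // x; have := h x; rewrite /= eq_sym F0 => ->.
Qed.

Let ext_fun_bot f : (forall x, g x != \bot%O) -> ext_fun f \bot%O = \bot%O.
Proof. by move=> h; apply: ext_fun_out => x; rewrite eq_sym. Qed.

Let ext_inj f : injective (ext_fun f).
Proof.
move=> F G; case: (rangeP F) => [x ->|-> h]; case: (rangeP G) => [y ->|-> h'].
- by rewrite !ext_funE => /g_inj/perm_inj->.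
- by rewrite ext_funE ext_fun_bot // => e; case/eqP: (h' (f x)).
- by rewrite ext_funE ext_fun_bot // => e; case/eqP: (h (f y)).
- by [].
Qed.

Let ext f : {perm P} := perm (@ext_inj f).

(** The bottom face is the only face that can be missed by [g]; it is fixed by
    all automorphisms, so an automorphism is determined by what it does on the
    range of [g]. *)
Lemma isog_embedding : rel_aut r \isog polytope_aut P.
Proof.
apply: (isog_of_fun (h := ext)) => [f f' _ _|f f' _ _ e|].
- apply/permP => F; rewrite permM !permE.
  case: (rangeP F) => [x ->|-> h]; first by rewrite !ext_funE permM.
  by rewrite !ext_fun_bot.
- apply/permP => x; apply: g_inj.
  by move/permP/(_ (g x)): e; rewrite !permE !ext_funE.
apply/setP => f; apply/imsetP/polytope_autP => [[f' /rel_autP f'P ->] F G|fP].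
  rewrite !permE.
  case: (rangeP F) => [x ->|-> h]; last by rewrite ext_fun_bot // !le0x.
  rewrite ext_funE; case: (rangeP G) => [y ->|-> h].
    by rewrite ext_funE !g_le f'P.
  by rewrite ext_fun_bot // !lex0 !(negPf (h _)).
have f0 : f \bot%O = \bot%O.
  by apply/eqP; rewrite -lex0 -[X in (_ <= X)%O](permKV f) fP le0x.
have ex x : exists y, f (g x) = g y.
  case: (rangeP (f (g x))) => [y ->|fx0 h]; first by exists y.
  by case/eqP: (h x); apply: (@perm_inj _ f); rewrite fx0 f0.
have [f1 f1P] := fin_all_exists ex.
have f1I : injective f1.
  by move=> x y e; apply: g_inj; apply: (@perm_inj _ f); rewrite !f1P e.
exists (perm f1I); first by apply/rel_autP => x y; rewrite !permE -!g_le -!f1P fP.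
apply/permP => F; rewrite permE.
case: (rangeP F) => [x ->|-> h]; first by rewrite ext_funE permE f1P.
by rewrite ext_fun_bot // f0.
Qed.

End Embedding.

(** * Products with powers of an antichain with a top element *)

(** The order is a plain relation, so that the same notion covers a polytope, its
    nonempty faces and a one-element poset. *)
Record top_poset := TopPoset {
  elt :> finType;
  leT : rel elt;
  topT : elt;
  leT_refl : reflexive leT;
  leT_anti : antisymmetric leT;
  leT_top : forall s, leT s topT
}.

Section Power.
Variables (S : top_poset) (X : finType) (k : nat).

Let coords := {ffun 'I_k -> option X}.
Implicit Types (s : S) (t u : coords) (i j : 'I_k) (x y : X) (p q : 'I_k * X).
Implicit Types (a b : S * coords).

(** The product order of [W^k], where [None] is the top of [W] and the [Some x]
    form an antichain. *)
Definition coord_le t u := [forall i, (u i == None) || (t i == u i)].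

Definition prod_le a b := leT a.1 b.1 && coord_le a.2 b.2.

Lemma coord_leP t u :
  reflect (forall i x, u i = Some x -> t i = Some x) (coord_le t u).
Proof.
apply: (iffP forallP) => h i.
  by move=> x e; have := h i; rewrite e /= => /eqP.
by case e : (u i) => [x|] //=; rewrite (h i x e).
Qed.

Lemma coord_le_refl : reflexive coord_le.
Proof. by move=> t; apply/coord_leP. Qed.

Lemma coord_le_anti : antisymmetric coord_le.
Proof.
move=> t u /andP[/coord_leP h1 /coord_leP h2]; apply/ffunP => i.
case e : (u i) => [x|]; first exact: h1.
by case e' : (t i) => [x|] //; rewrite -e; symmetry; rewrite (h2 i x).
Qed.

Lemma prod_le_refl : reflexive prod_le.
Proof. by move=> a; rewrite /prod_le leT_refl coord_le_refl. Qed.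

Lemma prod_le_anti : antisymmetric prod_le.
Proof.
move=> [s t] [s' t'] /andP[/andP[/= h1 h2] /andP[/= h3 h4]].
congr pair; first by apply: leT_anti; rewrite h1.
by apply: coord_le_anti; rewrite h2.
Qed.

(** The top element of [W^k]. *)
Definition full : coords := [ffun=> None].

(** The coatom of [W^k] with value [p.2] at the index [p.1]. *)
Definition single p : coords := [ffun j => if j == p.1 then Some p.2 else None].

Definition facet p : S * coords := (topT S, single p).

Lemma coord_le_full t : coord_le t full.
Proof. by apply/coord_leP => i x; rewrite ffunE. Qed.

Lemma coord_le_single t p : coord_le t (single p) = (t p.1 == Some p.2).
Proof.
apply/coord_leP/eqP => [|h j x]; first by apply; rewrite ffunE eqxx.
by rewrite ffunE; case: eqP => // -> [<-].
Qed.

Lemma le_facet a p : prod_le a (facet p) = (a.2 p.1 == Some p.2).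
Proof. by rewrite /prod_le leT_top coord_le_single. Qed.

Lemma facet_inj : injective facet.
Proof.
move=> [i x] [j y] e.
have : prod_le (facet (i, x)) (facet (j, y)) by rewrite e prod_le_refl.
by rewrite le_facet ffunE /=; case: (j =P i) => // -> /eqP[->].
Qed.

Definition incompatible (T : finType) (r : rel T) (a b : T) :=
  forall c, r c a -> r c b -> False.

(** For different indices the element carrying both values is a common lower
    bound; for equal indices a lower bound would need two values at once. *)
Lemma incompatible_facet p q :
  incompatible prod_le (facet p) (facet q) <-> p.1 = q.1 /\ p != q.
Proof.
case: p q => [i x] [j y] /=; split=> [h|[<- n] c].
  have [e|n] := eqVneq i j.
    split=> //; apply/eqP => -[_ exy]; apply: (h (facet (i, x))).
      exact: prod_le_refl.
    by rewrite e exy prod_le_refl.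
  case: (h (topT S, [ffun l => if l == i then Some x else
                     if l == j then Some y else None])).
    by rewrite le_facet ffunE /= eqxx.
  by rewrite le_facet ffunE /= [j == i]eq_sym (negPf n) eqxx.
rewrite !le_facet /= => /eqP-> /eqP[e].
by rewrite e eqxx in n.
Qed.

Section Aut.
Variable f : {perm (S * coords)}.
Hypothesis fP : f \in rel_aut prod_le.
Hypothesis f_facet : forall p, exists q, f (facet p) = facet q.
Hypothesis X_gt0 : X.

(** Distinct facets with the same index are exactly those without a common lower
    bound, a relation that [f] preserves; so [f] permutes the indices. *)
Lemma aut_facets : exists (sigma : {perm 'I_k}) (xi : 'I_k -> X -> X),
  (forall i, injective (xi i)) /\
  (forall i x, f (facet (i, x)) = facet (sigma i, xi i x)).
Proof.
have /rel_autP fle := fP.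
have [g gP] := fin_all_exists f_facet.
have gI : injective g.
  by move=> p q e; apply/facet_inj/(@perm_inj _ f); rewrite !gP e.
have disj p q : p.1 = q.1 /\ p != q <-> (g p).1 = (g q).1 /\ g p != g q.
  rewrite -!incompatible_facet -!gP; split=> h c.
    by rewrite -(permKV f c) !fle; apply: h.
  by move=> h1 h2; apply: (h (f c)); rewrite fle.
have g1 i x : (g (i, x)).1 = (g (i, X_gt0)).1.
  have [->//|n] := eqVneq x X_gt0.
  have /(disj (i, x) (i, X_gt0))[] // : i = i /\ (i, x) != (i, X_gt0).
  by rewrite xpair_eqE eqxx.
have sI : injective (fun i => (g (i, X_gt0)).1).
  move=> i j e; apply/eqP; apply: contraT => n.
  have /(disj (i, X_gt0) (j, X_gt0))[/= e' _] :
      (g (i, X_gt0)).1 = (g (j, X_gt0)).1 /\ g (i, X_gt0) != g (j, X_gt0).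
    by split=> //; rewrite (inj_eq gI) xpair_eqE (negPf n).
  by rewrite e' eqxx in n.
exists (perm sI), (fun i x => (g (i, x)).2); split=> [i x y e|i x].
  suff : g (i, x) = g (i, y) by move/gI => -[].
  by rewrite [LHS]surjective_pairing [RHS]surjective_pairing e !g1.
by rewrite permE gP -(g1 i x) -surjective_pairing.
Qed.

(** The coordinates of a face are read off the facets above it, and its first
    component off the least element above it that lies below no facet; both are
    therefore transported by [f]. *)
Lemma aut_prod_shape : exists (alpha : {perm S}) (sigma : {perm 'I_k})
    (xi : 'I_k -> X -> X),
  [/\ alpha \in rel_aut (@leT S), forall i, injective (xi i),
      forall a, (f a).1 = alpha a.1
    & forall a i, (f a).2 (sigma i) = omap (xi i) (a.2 i)].
Proof.
have /rel_autP fle := fP.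
have [sigma [xi [xiI facetP]]] := aut_facets.
have coordP a i : (f a).2 (sigma i) = omap (xi i) (a.2 i).
  have some x : ((f a).2 (sigma i) == Some (xi i x)) = (a.2 i == Some x).
    by have := fle a (facet (i, x)); rewrite facetP !le_facet.
  case e : (a.2 i) => [x|] /=; first by apply/eqP; rewrite some e.
  case e' : ((f a).2 (sigma i)) => [y|] //.
  have := some (invF (xiI i) y); rewrite f_invF e' e eqxx.
  by [].
have f_full s : f (s, full) = ((f (s, full)).1, full).
  rewrite [LHS]surjective_pairing; congr pair; apply/ffunP => i.
  by rewrite -(permKV sigma i) coordP !ffunE.
have aI : injective (fun s => (f (s, full)).1).
  move=> s s' e; have : f (s, full) = f (s', full) by rewrite f_full e -f_full.
  by move/perm_inj => -[].
have le_alpha s s' : leT (perm aI s) (perm aI s') = leT s s'.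
  have := fle (s, full) (s', full); rewrite f_full (f_full s') !permE.
  by rewrite /prod_le /= coord_le_refl !andbT.
exists (perm aI), sigma, xi; split=> //; first exact/rel_autP.
move=> a; apply: leT_anti; apply/andP; split.
  have : prod_le (f a) (f (a.1, full)).
    by rewrite fle /prod_le leT_refl coord_le_full.
  by rewrite permE => /andP[].
have le1 : prod_le a ((perm aI)^-1%g (f a).1, full).
  have f_top s : f (s, full) = (perm aI s, full) by rewrite permE -f_full.
  by rewrite -fle f_top permKV /prod_le leT_refl coord_le_full.
by rewrite -(permKV (perm aI) (f a).1) le_alpha; case/andP: le1.
Qed.

End Aut.

(** By [aut_prod_shape], a group that acts on the two factors and realizes all
    pairs of an automorphism of [S] and a permutation of the coordinates with
    relabellings of their values is the full automorphism group. *)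
Lemma isog_prod_aut (G : finGroupType) (psi : G -> {perm S})
    (beta : G -> coords -> coords) :
    X ->
    (forall f p, f \in rel_aut prod_le -> exists q, f (facet p) = facet q) ->
    {morph psi : c d / (c * d)%g} ->
    (forall c d t, beta (c * d)%g t = beta d (beta c t)) ->
    (forall c d, psi c = psi d -> beta c =1 beta d -> c = d) ->
    (forall c, psi c \in rel_aut (@leT S)) ->
    (forall c t u, coord_le (beta c t) (beta c u) = coord_le t u) ->
    (forall alpha (sigma : {perm 'I_k}) xi,
        alpha \in rel_aut (@leT S) -> (forall i, injective (xi i)) ->
      exists c, psi c = alpha /\
        forall t i, beta c t (sigma i) = omap (xi i) (t i)) ->
  rel_aut prod_le \isog [set: G].
Proof.
move=> X_gt0 f_facet psiM betaM faithful psiP betaP onto; rewrite isog_sym.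
have beta_inj c : injective (beta c).
  move=> t u e; apply: coord_le_anti.
  by rewrite -(betaP c t u) -(betaP c u t) e !coord_le_refl.
pose h c (a : S * coords) := (psi c a.1, beta c a.2).
have hI c : injective (h c).
  by move=> [s t] [s' t'] [/perm_inj -> /beta_inj ->].
apply: (isog_of_fun (h := fun c => perm (@hI c))) => [c d _ _|c d _ _ e|].
- by apply/permP => -[s t]; rewrite permM !permE /h /= psiM permM betaM.
- apply: faithful => [|t].
    apply/permP => s; move/permP/(_ (s, full)): e.
    by rewrite !permE => -[].
  by move/permP/(_ (topT S, t)): e; rewrite !permE => -[].
apply/setP => f; apply/imsetP/idP => [[c _ ->]|fP].
  apply/rel_autP => a b; rewrite !permE /prod_le /= betaP.
  by have /rel_autP-> := psiP c.
have [alpha [sigma [xi [alphaP xiI f1 f2]]]] :=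
  aut_prod_shape fP (f_facet f ^~ fP) X_gt0.
have [c [psi_c beta_c]] := onto _ sigma _ alphaP xiI.
exists c; rewrite ?inE //; apply/permP => a; rewrite permE.
rewrite [LHS]surjective_pairing /h f1 psi_c; congr pair.
by apply/ffunP => i; rewrite -(permKV sigma i) f2 beta_c.
Qed.

(** [B] is the automorphism group of [W^k], acting on the right through
    [beta]; the last condition asks for all elements of the wreath product of
    the permutations of [X] by those of the indices. *)
Definition coord_group (B : finGroupType) (beta : B -> coords -> coords) :=
  [/\ forall c d t, beta (c * d)%g t = beta d (beta c t),
      forall c d, beta c =1 beta d -> c = d,
      forall c t u, coord_le (beta c t) (beta c u) = coord_le t u
    & forall (sigma : {perm 'I_k}) xi, (forall i, injective (xi i)) ->
        exists c, forall t i, beta c t (sigma i) = omap (xi i) (t i)].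

(** The symbol null stands for a one-element base, whose factor disappears from
    the product. *)
Definition has_aut_group (A : option finGroupType) : Prop :=
  if A is Some A then rel_aut (@leT S) \isog [set: A]
  else forall s, s = topT S.

Lemma isog_power_aut (A : option finGroupType) (B : finGroupType)
    (beta : B -> coords -> coords) :
    X ->
    (forall f p, f \in rel_aut prod_le -> exists q, f (facet p) = facet q) ->
    coord_group beta -> has_aut_group A ->
  rel_aut prod_le \isog [set: null_prod A B].
Proof.
move=> X_gt0 f_facet [betaM faithful betaP onto]; case: A => [A|] /=.
  rewrite isog_sym => /isogP[psi /injmP psiI psi_im].
  apply: (isog_prod_aut (psi := fun c => psi c.1) (beta := fun c => beta c.2)) => //.
  - by move=> [a b] [a' b']; rewrite /= morphM ?inE.
  - by move=> [a b] [a' b'] t; rewrite /= betaM.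
  - by move=> [a b] [a' b'] /= e /faithful->; rewrite (psiI a a') ?inE.
  - by move=> [a b] /=; rewrite -psi_im mem_morphim ?inE.
  move=> alpha sigma xi; rewrite -psi_im => /morphimP[a _ _ ->] /onto-/(_ sigma)[b bP].
  by exists (a, b).
move=> S1; apply: (isog_prod_aut (psi := fun=> 1%g) (beta := beta)) => //.
- by move=> c d; rewrite mulg1.
- by move=> c d _; apply: faithful.
move=> alpha sigma xi _ /onto-/(_ sigma)[c cP]; exists c; split=> //.
by apply/permP => s; rewrite [LHS]S1 [RHS]S1.
Qed.

End Power.

Arguments coord_le {X k}.
Arguments prod_le {S X k}.
Arguments coord_group {X k B} beta.

(** * The symmetry groups of the powers *)

(** The inverse turns the composition of permutations into a right action. *)
Definition perm_coords k (s : sym k) (t : {ffun 'I_k -> option unit}) :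
  {ffun 'I_k -> option unit} := [ffun i => t ((s : {perm 'I_k})^-1%g i)].

Lemma perm_coords_group k : coord_group (@perm_coords k).
Proof.
split.
- by move=> s s' t; apply/ffunP => i; rewrite !ffunE invMg permM.
- move=> s s' e; apply: invg_inj; apply/permP => i; apply/eqP.
  pose t : {ffun 'I_k -> option unit} :=
    [ffun j => if j == (s^-1)%g i then Some tt else None].
  by move/ffunP/(_ i): (e t); rewrite !ffunE eqxx eq_sym; case: eqP.
- move=> s t u; apply/forallP/forallP => h i; last by rewrite !ffunE.
  by have := h (s i); rewrite !ffunE permK.
move=> sigma xi _; exists sigma => t i; rewrite ffunE permK.
by case: (t i) => [[]|] //=; case: (xi i tt).
Qed.

(** The pair [(s, v)] stands for the product of [s] and [v] in the semidirect
    product: first the coordinates are permuted by [s], then those where [v] is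
    nonzero are flipped. *)
Definition signed_coords k (c : signed_perm k) (t : {ffun 'I_k -> option bool}) :
    {ffun 'I_k -> option bool} :=
  [ffun i => omap (addb ((val c).2 ord0 i != 0%R)) (t ((val c).1^-1%g i))].

Lemma Z2_neq0D (z w : 'Z_2) : ((z + w)%R != 0%R) = (z != 0%R) (+) (w != 0%R).
Proof. by case: z w => [[|[|//]] ?] [[|[|//]] ?]. Qed.

Lemma Z2_neq0_inj (z w : 'Z_2) : (z != 0%R) = (w != 0%R) -> z = w.
Proof. by case: z w => [[|[|//]] ?] [[|[|//]] ?] // _; apply: val_inj. Qed.

Lemma signed_coords_group k : coord_group (@signed_coords k).
Proof.
split.
- move=> c d t; apply/ffunP => i; rewrite !ffunE /= invMg permM !mxE Z2_neq0D.
  by case: (t _) => //= b; rewrite addbA [(_ != _) (+) _]addbC.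
- move=> c d e; apply: val_inj.
  have e1 : (val c).1 = (val d).1.
    apply: invg_inj; apply/permP => i; apply/eqP.
    pose t : {ffun 'I_k -> option bool} :=
      [ffun j => if j == ((val c).1^-1)%g i then Some true else None].
    move/ffunP/(_ i): (e t); rewrite !ffunE eqxx.
    by case: (((val d).1^-1)%g i =P ((val c).1^-1)%g i) => [->|].
  rewrite [LHS]surjective_pairing [RHS]surjective_pairing e1; congr pair.
  apply/rowP => i; move/ffunP/(_ i): (e [ffun=> Some false]).
  by rewrite !ffunE /= !addbF => -[/Z2_neq0_inj].
- move=> c t u; apply/forallP/forallP => h i.
    have := h ((val c).1 i); rewrite !ffunE permK.
    case: (u i) => [b|] //= /eqP; case: (t i) => [a|] //= [/addbI->].
    exact: eqxx.
  by rewrite !ffunE; have /orP[/eqP->|/eqP->] := h ((val c).1^-1%g i);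
    rewrite ?eqxx ?orbT.
move=> sigma xi xiI.
(* An injective map of bool to itself is the flip exactly when it maps false to
   true. *)
pose v : 'rV['Z_2]_k := (\row_i if xi (sigma^-1%g i) false then 1 else 0)%R.
have cP : (sigma, v) \in setX [set: {perm 'I_k}] [set: 'rV['Z_2]_k] by rewrite !inE.
exists (SdPair _ cP) => t i; rewrite ffunE /= mxE !permK.
case: (t i) => [b|] //=; congr Some; have := xiI i.
case: b; case e1 : (xi i true); case e2 : (xi i false) => // xiIi.
  by have := xiIi true false; rewrite e1 e2 => /(_ erefl).
by have := xiIi true false; rewrite e1 e2 => /(_ erefl).
Qed.

(** * Recognizing the facets of a power *)

(** The poset is the disjoint union of the elements below [c] and those above
    some [v]. *)
Definition splits (T : finType) (r : rel T) (c : T) :=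
  exists v, forall x, r v x = ~~ r x c.

Lemma splits_aut (T : finType) (r : rel T) f c :
  f \in rel_aut r -> splits r c -> splits r (f c).
Proof.
move=> /rel_autP fP [v vP]; exists (f v) => x.
by rewrite -(permKV f x) !fP vP.
Qed.

Section SplitFacets.
Variables (S : top_poset) (bot : S) (k : nat).
Hypothesis bot_le : forall s, leT bot s.
Hypothesis S_nosplit : forall s, ~ splits (@leT S) s.

Let coords := {ffun 'I_k -> option unit}.
Let zero : coords := [ffun=> Some tt].
Let unit_vector i : coords := [ffun j => if j == i then None else Some tt].

Let zero_le t : coord_le zero t.
Proof. by apply/coord_leP => i [] _; rewrite ffunE. Qed.

(** The least element not below a facet has the top at the index of the facet and
    is as small as possible in all other components. *)
Lemma facet_splits p : splits (@prod_le S unit k) (facet S p).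
Proof.
exists (bot, unit_vector p.1) => -[s t].
rewrite le_facet /prod_le bot_le /=; apply/coord_leP/idP => [h|n i [] e].
  by apply/eqP => /(h _); rewrite ffunE eqxx.
rewrite ffunE; case: eqP => // ei; move: n; rewrite -ei e.
by case: (p.2); rewrite eqxx.
Qed.

(** Let [v] be the least element that is not below [a].  Each component in which
    [a] is not the top allows an element not below [a] that is the top in that
    component and minimal in all others.  If there were two such components, [v]
    would lie below both of these elements, hence be the bottom element and lie
    below [a].  So there is exactly one, and if it were the [S]-component, then
    that component would split [S]. *)
Lemma splits_facet a : splits (@prod_le S unit k) a -> exists p, a = facet S p.
Proof.
case: a => s t [[v u] vP].
have v_nle : ~~ prod_le (v, u) (s, t) by rewrite vP prod_le_refl.
have above b : ~~ prod_le b (s, t) -> prod_le (v, u) b by rewrite vP.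
have unit_above i : t i = Some tt -> leT v bot /\ coord_le u (unit_vector i).
  move=> ti; have /above/andP[] // : ~~ prod_le (bot, unit_vector i) (s, t).
  rewrite negb_and; apply/orP; right; apply/negP => /coord_leP/(_ i tt ti).
  by rewrite ffunE eqxx.
have low : leT v bot -> coord_le u zero -> False.
  move=> v0 u0; case/negP: v_nle; rewrite /prod_le /=.
  have -> : v = bot by apply: leT_anti; rewrite v0 bot_le.
  rewrite bot_le /=; have -> : u = zero by apply: coord_le_anti; rewrite u0 zero_le.
  exact: zero_le.
have zero_above : s != topT S -> coord_le u zero.
  move=> n; have /above/andP[] // : ~~ prod_le (topT S, zero) (s, t).
  rewrite negb_and; apply/orP; left; apply: contra n => /= le_s.
  by apply/eqP; apply: leT_anti; rewrite leT_top.
case: (pickP [pred i | t i != None]) => [i /= ti|t0].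
  have {}ti : t i = Some tt by case: (t i) ti => [[]|].
  have [v0 ui] := unit_above i ti.
  have es : s = topT S.
    by apply/eqP; apply: contraT => /zero_above/(low v0).
  exists (i, tt); rewrite es; congr pair; apply/ffunP => j; rewrite ffunE /=.
  case: (j =P i) => [->//|/eqP ji]; case tj : (t j) => [[]|] //.
  case: (low v0); apply/coord_leP => l []; have [_ uj] := unit_above j tj.
  have [->|li _] := eqVneq l i; last first.
    by apply: (coord_leP _ _ ui); rewrite ffunE (negPf li).
  by move=> _; apply: (coord_leP _ _ uj); rewrite ffunE eq_sym (negPf ji).
have {t0} et : t = full unit k.
  by apply/ffunP => i; rewrite ffunE; apply/eqP; have := t0 i => /= /negbFE.
have ns : s != topT S.
  apply: contraNneq v_nle => ->; by rewrite et /prod_le leT_top coord_le_full.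
have u0 := zero_above ns.
case: (@S_nosplit s); exists v => x; have := vP (x, zero).
by rewrite /prod_le /= u0 zero_le !andbT.
Qed.

Lemma splits_facet_aut f p : f \in rel_aut (@prod_le S unit k) ->
  exists q, f (facet S p) = facet S q.
Proof. by move=> fP; apply/splits_facet/splits_aut/facet_splits. Qed.

End SplitFacets.

Definition is_top (T : finType) (r : rel T) (c : T) := forall x, r x c.

Definition coatom (T : finType) (r : rel T) (c : T) :=
  ~ is_top r c /\ forall x, r c x -> x = c \/ is_top r x.

Lemma is_top_aut (T : finType) (r : rel T) (f : {perm T}) c :
  f \in rel_aut r -> is_top r (f c) <-> is_top r c.
Proof.
move=> /rel_autP fP; split=> h x; first by rewrite -fP.
by rewrite -(permKV f x) fP.
Qed.

Lemma coatom_aut (T : finType) (r : rel T) (f : {perm T}) c :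
  f \in rel_aut r -> coatom r c -> coatom r (f c).
Proof.
move=> fA; have /rel_autP fP := fA; move=> [nt h]; split; first by rewrite is_top_aut.
move=> x; rewrite -(permKV f x) fP is_top_aut // => /h[->|]; by [left|right].
Qed.

Section DisjointFacets.
Variables (S : top_poset) (k : nat).
Hypothesis S_meet : forall c d,
  coatom (@leT S) c -> coatom (@leT S) d -> ~ incompatible (@leT S) c d.

Let r := @prod_le S bool k.

Lemma facet_coatom p : coatom r (facet S p).
Proof.
split=> [/(_ (topT S, full _ _))|[s t]].
  by rewrite /r le_facet ffunE.
case/andP=> /= s1 /coord_leP h.
have -> : s = topT S by apply: leT_anti; rewrite leT_top.
case e : (t p.1) => [x|]; [left|right].
  congr pair; apply/ffunP => j; rewrite [RHS]ffunE; case: (j =P p.1) => [->|n].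
    by rewrite e -(h _ _ e) ffunE eqxx.
  case e' : (t j) => [y|] //; have := h _ _ e'; rewrite ffunE.
  by case: eqP.
have -> : t = full bool k.
  apply/ffunP => j; rewrite ffunE; case e' : (t j) => [y|] //.
  by have := h _ _ e'; rewrite ffunE; case: eqP e' => // ->; rewrite e.
by move=> a; rewrite /r /prod_le leT_top coord_le_full.
Qed.

(** A coatom has only one component that is not the top. *)
Lemma coatom_prod a : coatom r a ->
  (exists2 s, coatom (@leT S) s & a = (s, full bool k)) \/ exists p, a = facet S p.
Proof.
case: a => s t [nt h].
have top_inv b : is_top r b -> b = (topT S, full bool k).
  move=> hb; apply: (@prod_le_anti S bool k); apply/andP; split; last exact: hb.
  by rewrite /prod_le leT_top coord_le_full.
case: (pickP [pred i | t i != None]) => [i /=|t0]; last first.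
  have et : t = full bool k.
    by apply/ffunP => i; rewrite ffunE; apply/eqP; have := t0 i => /= /negbFE.
  left; exists s; last by rewrite et.
  split=> [s1|x sx].
    by apply: nt => b; rewrite /r /prod_le s1 et coord_le_full.
  have /h[[->]|/top_inv[-> _]] : r (s, t) (x, t).
  - by rewrite /r /prod_le sx coord_le_refl.
  - by left.
  by right; apply: leT_top.
case ti : (t i) => [x|] // _; right; exists (i, x).
have /h[//|/top_inv[/ffunP/(_ i)]] : r (s, t) (facet S (i, x)).
  by rewrite /r le_facet ti.
by rewrite !ffunE eqxx.
Qed.

(** The image of a facet is a coatom that has no common lower bound with another
    coatom, the image of the facet with the opposite value.  A coatom coming from
    [S] has common lower bounds with all facets, and by hypothesis with all other
    coatoms coming from [S]. *)
Lemma coatom_facet_aut f p : f \in rel_aut r ->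
  exists q, f (facet S p) = facet S q.
Proof.
move=> fA; have /rel_autP fP := fA; case: p => i x.
have disj : incompatible r (f (facet S (i, x))) (f (facet S (i, ~~ x))).
  have /incompatible_facet h : (i, x).1 = (i, ~~ x).1 /\ (i, x) != (i, ~~ x).
    by rewrite xpair_eqE eqxx; case: (x).
  by move=> c; rewrite -(permKV f c) !fP; apply: h.
have := coatom_prod (coatom_aut fA (facet_coatom (i, ~~ x))).
have [[s cs e]|//] := coatom_prod (coatom_aut fA (facet_coatom (i, x))).
move: disj; rewrite {}e => disj [[s' cs' e]|[q e]]; move: disj; rewrite {}e => disj.
  case: (S_meet cs cs') => c cs1 cs2.
  by apply: (disj (c, full _ _)); rewrite /r /prod_le /= coord_le_refl ?cs1 ?cs2.
case: (disj (s, single q)); first by rewrite /r /prod_le leT_refl coord_le_full.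
by rewrite /r /prod_le leT_top coord_le_refl.
Qed.

End DisjointFacets.

(** * Faces of prisms and pyramids *)

Lemma face_le_anti (P : polytope) : antisymmetric (fun F G : P => F <= G)%O.
Proof. exact: le_anti. Qed.

Definition face_poset (P : polytope) : top_poset :=
  @TopPoset P (fun F G => F <= G)%O \top%O (@lexx _ P) (@face_le_anti P) (@lex1 _ P).

Section Nonempty.
Variable P : polytope.
Hypothesis P_top : (\top : P)%O != \bot%O.

Let T := {F : P | F != \bot%O}.

Lemma nonempty_anti : antisymmetric (fun F G : T => val F <= val G)%O.
Proof. by move=> F G /le_anti/val_inj. Qed.

Definition nonempty_poset : top_poset :=
  @TopPoset T (fun F G => val F <= val G)%O (Sub \top%O P_top)
    (fun F => lexx (val F)) nonempty_anti (fun F => lex1 (val F)).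

End Nonempty.

(** The isomorphism of [W] for two values with the nonempty faces of the edge;
    the top of [W] is the edge itself. *)
Definition vertex (w : option bool) : edge :=
  match w with Some b => (b, ~~ b) | None => (true, true) end.

Lemma vertex_neq0 w : vertex w != \bot%O.
Proof. by case: w => [[]|]. Qed.

Lemma vertex_le v w : (vertex v <= vertex w)%O = (w == None) || (v == w).
Proof. by case: v w => [[]|] [[]|]. Qed.

Lemma vertexP (e : edge) : e != \bot%O -> exists w, e = vertex w.
Proof.
case: e => [[] []] // _; by [exists None|exists (Some true)|exists (Some false)].
Qed.

Section ProductFaces.
Variables P Q : polytope.
Implicit Types (F : P) (G : Q).

(** The product face is meaningful for nonempty [F] and [G] only; the default
    value is the empty face. *)
Definition pface F G : product P Q := insubd (cartesian_bot P Q) ((F, G) : (P *p Q)%type).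

Lemma val_pface F G : F != \bot%O -> G != \bot%O ->
  val (pface F G) = (F, G) :> (P *p Q)%type.
Proof.
move=> F0 G0.
have [r1 r1P] := polytope_gradedP.1 (polytopeP P).
have [r2 r2P] := polytope_gradedP.1 (polytopeP Q).
exact: (val_to_cartesian r1P r2P).
Qed.

Lemma pface_le F F' G G' :
    F != \bot%O -> F' != \bot%O -> G != \bot%O -> G' != \bot%O ->
  (pface F G <= pface F' G')%O = (F <= F')%O && (G <= G')%O.
Proof. by move=> *; rewrite cartesian_leE !val_pface. Qed.

Lemma pface_neq0 F G : F != \bot%O -> G != \bot%O -> pface F G != \bot%O.
Proof.
move=> F0 G0; apply/eqP => /(congr1 val).
by rewrite val_pface // => -[e]; rewrite e eqxx in F0.
Qed.

Lemma pfaceP (x : product P Q) : x != \bot%O ->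
  exists F G, [/\ F != \bot%O, G != \bot%O & x = pface F G].
Proof.
have [r1 r1P] := polytope_gradedP.1 (polytopeP P).
have [r2 r2P] := polytope_gradedP.1 (polytopeP Q).
move=> /(cartesian_nbot r1P r2P); case e : (val x) => [F G] /= /andP[F0 G0].
by exists F, G; split=> //; apply: val_inj; rewrite val_pface.
Qed.

Lemma pface_top : (\top : P)%O != \bot%O -> (\top : Q)%O != \bot%O ->
  pface \top%O \top%O = \top%O.
Proof.
move=> P0 Q0; have top0 : (\top : product P Q)%O != \bot%O.
  by apply: contraNneq (pface_neq0 P0 Q0) => e; rewrite -lex0 -e lex1.
have [F [G [F0 G0 e]]] := pfaceP top0.
by apply/eqP; rewrite -le1x e pface_le // !lex1.
Qed.

End ProductFaces.

(** The form in which positive rank enters the arguments on prisms and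
    pyramids. *)
Definition has_disjoint_faces (P : polytope) := exists F G : P,
  [/\ F != \bot%O, G != \bot%O & forall H, (H <= F)%O -> (H <= G)%O -> H = \bot%O].

Lemma disjoint_faces_top (P : polytope) :
  has_disjoint_faces P -> (\top : P)%O != \bot%O.
Proof. by move=> [F [_ [F0 _ _]]]; rewrite -lt0x (lt_le_trans _ (lex1 F)) ?lt0x. Qed.

Lemma disjoint_faces_between (P : polytope) :
  has_disjoint_faces P -> exists F : P, F != \bot%O /\ F != \top%O.
Proof.
move=> [F [G [F0 G0 h]]]; exists F; split=> //; apply: contraNneq G0 => e.
by apply/eqP/h; rewrite // e lex1.
Qed.

(** Two ends of the edge, the two bases of a prism, the base and the apex of a
    pyramid. *)
Lemma construction_disjoint_faces c : has_disjoint_faces (polytope_of c).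
Proof.
elim: c => [|c /disjoint_faces_top P0|c /disjoint_faces_top P0] /=.
- exists (vertex (Some true)), (vertex (Some false)); split=> //.
  by case=> [[] []].
- exists (pface \top%O (vertex (Some true))), (pface \top%O (vertex (Some false))).
  split; try exact: pface_neq0.
  move=> H H1 H2; apply/eqP; apply: contraT => /pfaceP[F [e [F0 /[dup] e0]]].
  move=> /vertexP[w ew] eH; move: H1 H2; rewrite eH !pface_le ?vertex_neq0 //.
  by rewrite ew !vertex_le; case: (w) => [[]|]; rewrite ?andbF.
pose P := polytope_of c.
exists ((\top%O, false) : join P point), ((\bot%O, true) : join P point); split.
- by apply: contraNneq P0 => -[->].
- by apply/eqP => -[].
by move=> [F []] /andP[/= ? ?] /andP[/= F0 _] //; move: F0; rewrite lex0 => /eqP->.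
Qed.

(** Suppose that each face is either above [v] or below [c], but never both.
    The two bases of the prism cannot both lie above [v], which would be empty,
    nor both below [c], which would be the whole prism.  So one base, say the
    one at the end [b], is above [v] and [c] is the other base.  All nonempty
    faces [F * b] are then above [v = a * b], so [a] is a least nonempty face of
    [P], which cannot lie in two disjoint faces. *)
Lemma prism_nosplit (P : polytope) : has_disjoint_faces P ->
  forall c : face_poset (product P edge), ~ splits (@leT _) c.
Proof.
move=> hP c [v vP]; have P0 := disjoint_faces_top hP.
have {}vP x : (v <= x)%O = ~~ (x <= c)%O := vP x.
have vc : ~~ (v <= c)%O by rewrite vP lexx.
have v0 : v != \bot%O by apply: contraNneq vc => ->; rewrite le0x.
have [a [s [a0 s0 ev]]] := pfaceP v0; have [w ew] := vertexP s0.
pose e b : product P edge := pface \top%O (vertex (Some b)).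
have e_le b : (v <= e b)%O = (w == Some b).
  by rewrite ev pface_le ?vertex_neq0 // lex1 ew vertex_le.
have c_le x : (x <= c)%O = ~~ (v <= x)%O by rewrite vP negbK.
have c0 : c != \bot%O.
  apply/eqP => c0; have := e_le true; have := e_le false.
  rewrite !vP c0 !lex0 !pface_neq0 ?vertex_neq0 //.
  by move=> /esym/eqP-> /esym/eqP.
have [r [u' [r0 u0 ec]]] := pfaceP c0; have [u eu] := vertexP u0.
have e_c b : (e b <= c)%O = (r == \top%O) && ((u == None) || (u == Some b)).
  rewrite ec pface_le ?vertex_neq0 // le1x eu vertex_le.
  by rewrite [u == Some b]eq_sym.
have [b wb] : exists b, w = Some b.
  case: (w) (e_le) => [b _|h]; first by exists b.
  have := c_le (e true); have := c_le (e false); rewrite !h !e_c.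
  case: eqP => //= r1; case: (u) eu => [[]|] // eu _ _.
  by case/negP: vc; rewrite ec r1 eu (@pface_top P edge) ?lex1.
have uc : u = Some (~~ b).
  have := c_le (e b); have := c_le (e (~~ b)); rewrite !e_le wb !e_c.
  by case: (r == _); case: (b); case: (u) => [[]|].
have below F : F != \bot%O -> (a <= F)%O.
  move=> F0; have : (v <= pface F (vertex (Some b)))%O.
    rewrite vP ec pface_le ?vertex_neq0 // eu uc vertex_le.
    by case: (b); rewrite andbF.
  by rewrite ev pface_le ?vertex_neq0 // => /andP[].
case: hP => F [G [F0 G0 /(_ a)]]; rewrite !below // => /(_ isT isT) e0.
by rewrite e0 eqxx in a0.
Qed.

(** A coatom of the pyramid is either its base or contains the apex and a
    nonempty face of the base.  Two coatoms of the second kind share the apex;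
    one of the second kind shares a nonempty face with the base. *)
Lemma pyramid_meet (P : polytope) (h : (\top : join P point)%O != \bot%O) :
    has_disjoint_faces P ->
  forall c d : nonempty_poset h,
    coatom (@leT _) c -> coatom (@leT _) d -> ~ incompatible (@leT _) c d.
Proof.
move=> hP; have P0 := disjoint_faces_top hP.
have [Z [Z0 Z1]] := disjoint_faces_between hP.
have base_neq0 : ((\top%O, false) : join P point) != \bot%O.
  by apply: contraNneq P0 => -[->].
have apex_neq0 F : ((F, true) : join P point) != \bot%O by apply/eqP => -[].
have coatomP (c : nonempty_poset h) : coatom (@leT _) c ->
    val c = (\top%O, false) \/ exists2 F, F != \bot%O & val c = (F, true).
  case: c => -[F b] c0 [_ hc].
  have {}hc x (x0 : x != \bot%O) :
      ((F, b) <= x :> join P point)%O -> x = (F, b) \/ (\top <= x)%O.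
    move=> /(hc (exist _ x x0))[/(congr1 val)|/(_ (topT _))]; by [left|right].
  case: b => /= in c0 hc *; [right|left]; last first.
    have /hc[//|<-//|] : ((F, false) <= (\top, false) :> join P point)%O.
      by rewrite Order.ProdOrder.leEprod /= lex1.
    by case/andP.
  exists F => //; apply: contraNneq Z1 => F0.
  have /hc[//|[e]|/andP[/=]] : ((F, true) <= (Z, true) :> join P point)%O.
  - by rewrite Order.ProdOrder.leEprod /= F0 le0x.
  - by rewrite e F0 eqxx in Z0.
  - by rewrite le1x.
have common (c d : nonempty_poset h) (e : join P point) :
    e != \bot%O -> (e <= val c)%O -> (e <= val d)%O -> ~ incompatible (@leT _) c d.
  by move=> e0 ec ed /(_ (exist _ e e0)); apply.
move=> c d /coatomP[ec|[F F0 ec]] /coatomP[ed|[G G0 ed]].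
- by apply: (common c d _ base_neq0); rewrite ?ec ?ed.
- apply: (common c d ((G, false) : join P point)).
  + by apply: contraNneq G0 => -[->].
  + by rewrite ec Order.ProdOrder.leEprod /= lex1.
  + by rewrite ed Order.ProdOrder.leEprod /= lexx.
- apply: (common c d ((F, false) : join P point)).
  + by apply: contraNneq F0 => -[->].
  + by rewrite ec Order.ProdOrder.leEprod /= lexx.
  + by rewrite ed Order.ProdOrder.leEprod /= lex1.
- apply: (common c d _ (apex_neq0 \bot%O)).
  + by rewrite ec Order.ProdOrder.leEprod /= le0x.
  + by rewrite ed Order.ProdOrder.leEprod /= le0x.
Qed.

(** * Polytopes as powers over a base *)

(** [g] is an isomorphism of [S * W^k] onto the faces in [D]. *)
Definition decomposition (S : top_poset) (X : finType) k (P : polytope)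
    (D : pred P) (g : S * {ffun 'I_k -> option X} -> P) :=
  (forall a b, (g a <= g b)%O = prod_le a b) /\
  (forall F, D F <-> exists a, F = g a).

Definition nonempty (P : polytope) : pred P := fun F => F != \bot%O.
Arguments nonempty : clear implicits.

Lemma decomposition_aut (S : top_poset) (X : finType) k (P : polytope) (D : pred P)
    (g : S * {ffun 'I_k -> option X} -> P) :
    decomposition D g -> (forall F, F != \bot%O -> D F) ->
  rel_aut (@prod_le S X k) \isog polytope_aut P.
Proof.
move=> [g_le gD] DP; apply: (isog_embedding g_le).
  by move=> F /DP/gD.
by move=> a b e; apply: prod_le_anti; rewrite -!g_le e lexx.
Qed.

Lemma face_poset_aut P : rel_aut (@leT (face_poset P)) \isog polytope_aut P.
Proof. by apply: (isog_embedding (g := id)) => // F; exists F. Qed.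

Lemma nonempty_poset_aut (P : polytope) (h : (\top : P)%O != \bot%O) :
  rel_aut (@leT (nonempty_poset h)) \isog polytope_aut P.
Proof.
apply: (isog_embedding (g := val)) => // [F F0|]; last exact: val_inj.
by exists (Sub F F0).
Qed.

(** The coordinate of index 0 is the one added by the last operation. *)
Definition coord_tail (X : Type) k (u : {ffun 'I_k.+1 -> option X}) :
  {ffun 'I_k -> option X} := [ffun j => u (lift ord0 j)].

Definition coord_cons (X : Type) k (w : option X) (t : {ffun 'I_k -> option X}) :
    {ffun 'I_k.+1 -> option X} :=
  [ffun i => if unlift ord0 i is Some j then t j else w].

Lemma coord_cons0 (X : Type) k w (t : {ffun 'I_k -> option X}) :
  coord_cons w t ord0 = w.
Proof. by rewrite ffunE unlift_none. Qed.

Lemma coord_tail_cons (X : Type) k w (t : {ffun 'I_k -> option X}) :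
  coord_tail (coord_cons w t) = t.
Proof. by apply/ffunP => j; rewrite !ffunE liftK. Qed.

Lemma coord_le_split (X : finType) k (u v : {ffun 'I_k.+1 -> option X}) :
  coord_le u v =
    ((v ord0 == None) || (u ord0 == v ord0)) && coord_le (coord_tail u) (coord_tail v).
Proof.
apply/forallP/andP => [h|[h0 /forallP h] i].
  by split; [exact: h|apply/forallP => j; rewrite !ffunE].
by case: (unliftP ord0 i) => [j ->|->] //; have := h j; rewrite !ffunE.
Qed.

Lemma decomposition_join (S : top_poset) k (P : polytope)
    (g : S * {ffun 'I_k -> option unit} -> P) :
    decomposition predT g ->
  decomposition predT (fun a : S * {ffun 'I_k.+1 -> option unit} =>
    (g (a.1, coord_tail a.2), a.2 ord0 == None) : join P point).
Proof.
move=> [g_le gD]; split=> [[s u] [s' u']|[F b]].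
  rewrite Order.ProdOrder.leEprod /= g_le /prod_le /= coord_le_split.
  rewrite -andbA; congr andb; rewrite andbC; congr andb.
  by case: (u ord0) (u' ord0) => [[]|] [[]|].
split=> // _; have [[s t] ->] := (gD F).1 isT.
exists (s, coord_cons (if b then None else Some tt) t).
by rewrite /= coord_tail_cons coord_cons0; case: b.
Qed.

Lemma decomposition_product (S : top_poset) k (P : polytope)
    (g : S * {ffun 'I_k -> option bool} -> P) :
    decomposition (nonempty P) g ->
  decomposition (nonempty (product P edge))
    (fun a : S * {ffun 'I_k.+1 -> option bool} =>
       pface (g (a.1, coord_tail a.2)) (vertex (a.2 ord0))).
Proof.
move=> [g_le gD].
have g0 a : g a != \bot%O by apply/gD; exists a.
split=> [[s u] [s' u']|F].
  rewrite pface_le ?vertex_neq0 // vertex_le g_le /prod_le /= coord_le_split.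
  by rewrite -andbA; congr andb; rewrite andbC.
split=> [/pfaceP[G [e [/gD[[s t] ->] /vertexP[w ->] ->]]]|[a ->]].
  by exists (s, coord_cons w t); rewrite /= coord_tail_cons coord_cons0.
by rewrite /nonempty pface_neq0 ?vertex_neq0.
Qed.

Lemma coords0_eq (X : finType) (t u : {ffun 'I_0 -> option X}) : t = u.
Proof. by apply/ffunP => -[]. Qed.

Lemma decomposition_faces (P : polytope) :
  decomposition predT (fun a : face_poset P * {ffun 'I_0 -> option unit} => a.1).
Proof.
split=> [[s t] [s' t']|F]; last by split=> // _; exists (F, [ffun=> None]).
by rewrite /prod_le /= (coords0_eq t t') coord_le_refl andbT.
Qed.

Lemma decomposition_nonempty (P : polytope) (h : (\top : P)%O != \bot%O) :
  decomposition (nonempty P)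
    (fun a : nonempty_poset h * {ffun 'I_0 -> option bool} => val a.1).
Proof.
split=> [[s t] [s' t']|F].
  by rewrite /prod_le /= (coords0_eq t t') coord_le_refl andbT.
split=> [F0|[[s t] ->]]; last exact: (valP s).
by exists (Sub F F0, [ffun=> None]).
Qed.

Lemma unit_anti : antisymmetric (fun _ _ : unit => true).
Proof. by case=> [] []. Qed.

Definition unit_poset : top_poset :=
  @TopPoset unit (fun _ _ => true) tt (fun=> isT) unit_anti (fun=> isT).

Lemma decomposition_point :
  decomposition predT (fun a : unit_poset * {ffun 'I_1 -> option unit} =>
    (a.2 ord0 == None) : point).
Proof.
split=> [[s u] [s' u']|b].
  rewrite /prod_le /= coord_le_split (coords0_eq (coord_tail u) (coord_tail u')).
  by rewrite coord_le_refl andbT; case: (u ord0) (u' ord0) => [[]|] [[]|].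
split=> // _; exists (tt, [ffun=> if b then None else Some tt]).
by rewrite ffunE; case: b.
Qed.

Lemma decomposition_edge :
  decomposition (nonempty edge)
    (fun a : unit_poset * {ffun 'I_1 -> option bool} => vertex (a.2 ord0)).
Proof.
split=> [[s u] [s' u']|F].
  rewrite /prod_le /= coord_le_split (coords0_eq (coord_tail u) (coord_tail u')).
  by rewrite coord_le_refl andbT vertex_le.
split=> [/vertexP[w ->]|[a ->]]; last exact: vertex_neq0.
by exists (tt, [ffun=> w]); rewrite ffunE.
Qed.

(** * The invariant of the construction *)

Definition predicted_group (d : attached_data) : finGroupType :=
  null_prod (group_A d)
    (if kind_prod d is kind_cartesian then signed_perm (int_k d) else sym (int_k d)).

(** The invariant of the construction.  The last requirements in each case are
    those that make automorphisms permute the facets. *)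
Definition structured (P : polytope) (d : attached_data) : Prop :=
  let: Attached A k kind := d in
  match kind with
  | kind_cartesian =>
      exists (S : top_poset) (g : S * {ffun 'I_k -> option bool} -> P),
        [/\ decomposition (nonempty P) g, has_aut_group S A &
            forall c d, coatom (@leT S) c -> coatom (@leT S) d ->
              ~ incompatible (@leT S) c d]
  | kind_join =>
      exists (S : top_poset) (g : S * {ffun 'I_k -> option unit} -> P),
        [/\ decomposition predT g, has_aut_group S A,
            exists bot, forall s : S, leT bot s &
            forall s, ~ splits (@leT S) s]
  end.

Lemma structured_aut P d :
  structured P d -> polytope_aut P \isog [set: predicted_group d].
Proof.
case: d => A k [] /= [S [g []]].
  move=> dec autS meet; rewrite isog_sym.
  apply: isog_trans (decomposition_aut dec _) => //; rewrite isog_sym.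
  apply: (isog_power_aut true _ (@signed_coords_group k) autS).
  by move=> f p; apply: coatom_facet_aut.
move=> dec autS [bot bot_le] nosplit; rewrite isog_sym.
apply: isog_trans (decomposition_aut dec _) => //; rewrite isog_sym.
apply: (isog_power_aut tt _ (@perm_coords_group k) autS).
by move=> f p; apply: splits_facet_aut bot_le nosplit _ _.
Qed.

Lemma attached_JoinPt c : attached (JoinPt c) =
  if c is Edge then Attached None 3 kind_join else
  let: Attached A k kind := attached c in
  if kind is kind_cartesian then
    Attached (Some (null_prod A (signed_perm k))) 1 kind_join
  else Attached A k.+1 kind_join.
Proof. by case: c. Qed.

Lemma kind_TimesI c : kind_prod (attached (TimesI c)) = kind_cartesian.
Proof. by rewrite /=; case: (attached c) => A k []. Qed.

Lemma kind_JoinPt c : kind_prod (attached (JoinPt c)) = kind_join.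
Proof. by rewrite attached_JoinPt; case: c => // c; case: (attached _) => A k []. Qed.

(** Following a product the exponent grows by one; following a join the whole
    polytope, a pyramid, becomes the base, and the exponent restarts from 1. *)
Lemma structured_TimesI c : structured (polytope_of c) (attached c) ->
  structured (polytope_of (TimesI c)) (attached (TimesI c)).
Proof.
move=> IHc; have autP := structured_aut IHc; rewrite [attached (TimesI c)]/=.
have [kc|[c' ec]] : kind_prod (attached c) = kind_cartesian \/ exists c', c = JoinPt c'.
- by case: (c) => [|c'|c']; [left|left; exact: kind_TimesI|right; exists c'].
- move: (attached c) kc IHc {autP} => [A k kind] /= ->.
  move=> [S [g [/decomposition_product dec autS meet]]].
  by exists S; eexists; split; first exact: dec.
move: (kind_JoinPt c'); rewrite -ec.
move: (attached c) autP {IHc} => [A k kind] /= autP kc; rewrite kc in autP *.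
have h := disjoint_faces_top (construction_disjoint_faces (JoinPt c')).
rewrite ec in autP *; exists (nonempty_poset h); eexists; split.
- exact: decomposition_product (decomposition_nonempty h).
- exact: isog_trans (nonempty_poset_aut h) autP.
- exact: pyramid_meet (construction_disjoint_faces c').
Qed.

(** Following a join the exponent grows by one; following a product the whole
    polytope, a prism, becomes the base.  The triangle is special: the edge is itself an
    iterated join of points, so the triangle is the third power of [pt] over a
    one-element base, whence the exponent 3. *)
Lemma structured_JoinPt c : structured (polytope_of c) (attached c) ->
  structured (polytope_of (JoinPt c)) (attached (JoinPt c)).
Proof.
move=> IHc; have autP := structured_aut IHc; rewrite attached_JoinPt.
case: c IHc autP => [|c|c] IHc autP.
- exists unit_poset; eexists; split.
  + exact/decomposition_join/decomposition_join/decomposition_point.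
  + by case.
  + by exists tt.
  + by move=> s [v /(_ tt)].
- move: (attached _) (kind_TimesI c) autP {IHc} => [A k kind] /= -> autP.
  exists (face_poset (polytope_of (TimesI c))); eexists; split.
  + exact: decomposition_join (decomposition_faces _).
  + exact: isog_trans (face_poset_aut (polytope_of (TimesI c))) autP.
  + by exists \bot%O => s; apply: le0x.
  + exact: prism_nosplit (construction_disjoint_faces c).
move: (attached _) (kind_JoinPt c) IHc {autP} => [A k kind] /= ->.
move=> [S [g [/decomposition_join dec autS bot nosplit]]].
by exists S; eexists; split; first exact: dec.
Qed.

Lemma construction_structured c : structured (polytope_of c) (attached c).
Proof.
elim: c => [|c|c]; [|exact: structured_TimesI|exact: structured_JoinPt].
exists unit_poset; eexists; split; first exact: decomposition_edge.
  by case.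
by move=> c d [[]].
Qed.

Unset Implicit Arguments.

Theorem mainTheorem2 (c : construction) :
  let P := polytope_of c in
  let A := group_A (attached c) in
  let k := int_k (attached c) in
  (kind_prod (attached c) = kind_cartesian ->
     polytope_aut P \isog [set: null_prod A (signed_perm k)]) /\
  (kind_prod (attached c) = kind_join ->
     polytope_aut P \isog [set: null_prod A (sym k)]).
Proof.
move=> P A k; have := structured_aut (construction_structured c).
by rewrite /predicted_group => autP; split=> kc; rewrite kc in autP.
Qed.
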